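(* Consider the modal formulas $7^\star$: $(p\to q)\supset[(r\to p)\to(r\to q)]$; $8^\star$: $(p\to q)\supset[(q\to r)\to(p\to r)]$; $9^\star$: $[(p\to q)\land(q\to r)]\supset(p\to r)$; $10^\star$: $[p\land(p\to q)]\supset q$. The normal modal logics $\mathbf{K}_2\oplus\{7^\star,8^\star,9^\star\}$ and $\mathbf{K}_2\oplus\{7^\star,8^\star,10^\star\}$ are undecidable. That is, the modal logic (set of valid formulas) of the class of Kripke frames $(W,R)$ satisfying, for all $x,y,z\in W$, $$(x\cdot y)\cdot z\subseteq x\cdot(y\cdot z),\qquad (x\cdot y)\cdot z\subseteq y\cdot(x\cdot z),\qquad x\cdot y\subseteq x\cdot(x\cdot y)$$ is undecidable; and so is the modal logic of the class of Kripke frames $(W,R)$ satisfying, for all $x,y,z\in W$, $$(x\cdot y)\cdot z\subseteq x\cdot(y\cdot z),\qquad (x\cdot y)\cdot z\subseteq y\cdot(x\cdot z),\qquad x\in x\cdot x .$$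
   Context: Modal language: formulas generated by $\varphi::=\bot\mid\top\mid p\mid\neg\varphi\mid\varphi\lor\varphi\mid\Diamond(\varphi,\varphi)$ over propositional variables, with a binary modality $\Diamond$; conjunction $\land$ and material implication $\supset$ are defined as usual. The expression $\alpha\to\beta$ abbreviates $\neg\Diamond(\alpha,\neg\beta)$. A Kripke frame is a pair $(W,R)$ with $R\subseteq W^3$; a Kripke model adds a valuation $V$ from propositional variables to subsets of $W$. Boolean clauses are the usual ones and $w\vDash\Diamond(\varphi,\psi)$ iff there are $v,u\in W$ with $Rwvu$, $v\vDash\varphi$ and $u\vDash\psi$. A formula is valid on a frame if it is true at all points under all valuations. $\mathbf{K}_2$ is the least normal modal logic in this language (equivalently, the set of formulas valid on all Kripke frames), and $\mathbf{K}_2\oplus\Psi$ is the least normal modal logic containing $\Psi$. For a frame $(W,R)$, put $x\cdot y:=\{z\in W\mid Rxyz\}$, and for $X,Y\subseteq W$ put $X\cdot Y:=\bigcup_{x\in X,y\in Y}x\cdot y$; a point $x$ next to a set is read as $\{x\}$. *)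

(* Defs.v *)
From mathcomp Require Import all_boot.
From mathcomp Require Import boolp classical_sets.

Set Implicit Arguments.
Unset Strict Implicit.
Unset Printing Implicit Defensive.

Declare Scope modal_scope.
Delimit Scope modal_scope with M.
Local Open Scope classical_set_scope.

Inductive formula : Type :=
| Bot
| Top
| Var of nat
| Neg of formula
| Or of formula & formula
| Dia of formula & formula.

Bind Scope modal_scope with formula.
Arguments Neg _%_M.
Arguments Or (_ _)%_M.
Arguments Dia (_ _)%_M.

Definition And (a b : formula) := Neg (Or (Neg a) (Neg b)).
Definition Imp (a b : formula) := Or (Neg a) b.
Definition Arrow (a b : formula) := Neg (Dia a (Neg b)).

Local Notation "a ∧ b" := (And a b) (at level 40, left associativity) : modal_scope.
Local Notation "a ⊃ b" := (Imp a b) (at level 55, right associativity) : modal_scope.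
Local Notation "a → b" := (Arrow a b) (at level 52, no associativity) : modal_scope.

Fixpoint sat (W : Type) (R : W -> W -> W -> Prop) (V : nat -> set W)
    (w : W) (a : formula) : Prop :=
  match a with
  | Bot => False
  | Top => True
  | Var i => V i w
  | Neg b => ~ sat R V w b
  | Or b c => sat R V w b \/ sat R V w c
  | Dia b c => exists v u, [/\ R w v u, sat R V v b & sat R V u c]
  end.

Definition valid (W : Type) (R : W -> W -> W -> Prop) (a : formula) : Prop :=
  forall (V : nat -> set W) (w : W), sat R V w a.

Definition frame_class := forall W : Type, (W -> W -> W -> Prop) -> Prop.

Definition logic_of (C : frame_class) : set formula :=
  [set a | forall (W : Type) (R : W -> W -> W -> Prop), C W R -> valid R a].

Definition dot (W : Type) (R : W -> W -> W -> Prop) (X Y : set W) : set W :=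
  \bigcup_(x in X) \bigcup_(y in Y) [set z | R x y z].

Fixpoint subst (s : nat -> formula) (a : formula) : formula :=
  match a with
  | Bot => Bot
  | Top => Top
  | Var i => s i
  | Neg b => Neg (subst s b)
  | Or b c => Or (subst s b) (subst s c)
  | Dia b c => Dia (subst s b) (subst s c)
  end.

(* Formulas headed by the modality count as atoms. *)
Fixpoint truth (v : formula -> bool) (a : formula) : bool :=
  match a with
  | Bot => false
  | Top => true
  | Var _ | Dia _ _ => v a
  | Neg b => ~~ truth v b
  | Or b c => truth v b || truth v c
  end.

Definition tautology (a : formula) : Prop :=
  forall v : formula -> bool, truth v a.

Definition Box (a b : formula) := Neg (Dia (Neg a) (Neg b)).

(* The usual notion for a language with a primitive polyadic diamond: one axiom
   K and one generalization rule per argument place, and the axiom Dual, split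
   here into its two implications. *)
Record normal (L : set formula) : Prop := Normal {
  normal_taut : forall a, tautology a -> L a;
  normal_K1 : L (Box (Var 0 ⊃ Var 1) (Var 2) ⊃
                 (Box (Var 0) (Var 2) ⊃ Box (Var 1) (Var 2)))%M;
  normal_K2 : L (Box (Var 2) (Var 0 ⊃ Var 1) ⊃
                 (Box (Var 2) (Var 0) ⊃ Box (Var 2) (Var 1)))%M;
  normal_dual1 : L (Dia (Var 0) (Var 1) ⊃
                    Neg (Box (Neg (Var 0)) (Neg (Var 1))))%M;
  normal_dual2 : L (Neg (Box (Neg (Var 0)) (Neg (Var 1))) ⊃
                    Dia (Var 0) (Var 1))%M;
  normal_mp : forall a b, L (a ⊃ b)%M -> L a -> L b;
  normal_subst : forall s a, L a -> L (subst s a);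
  normal_gen1 : forall a b, L a -> L (Box a b);
  normal_gen2 : forall a b, L a -> L (Box b a)
}.

Definition K2_plus (Psi : set formula) : set formula :=
  [set a | forall L : set formula, normal L -> Psi `<=` L -> L a].

Inductive recfun : nat -> Type :=
| RZero : recfun 0
| RSucc : recfun 1
| RProj n : 'I_n -> recfun n
| RComp k n : recfun k -> ('I_k -> recfun n) -> recfun n
| RPrim n : recfun n -> recfun n.+2 -> recfun n.+1
| RMu n : recfun n.+1 -> recfun n.

(* [computes f v y]: the partial function denoted by [f] is defined at [v], with
   value [y].  In [RPrim], [s i] is the value at recursion argument [i]. *)
Fixpoint computes n (f : recfun n) : n.-tuple nat -> nat -> Prop :=
  match f in recfun n return n.-tuple nat -> nat -> Prop with
  | RZero => fun _ y => y = 0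
  | RSucc => fun v y => y = (thead v).+1
  | RProj _ i => fun v y => y = tnth v i
  | RComp k _ g h => fun v y =>
      exists2 w : k.-tuple nat,
        forall i, computes (h i) v (tnth w i) & computes g w y
  | RPrim _ g h => fun v y =>
      exists s : nat -> nat,
        [/\ computes g (behead_tuple v) (s 0),
            forall i, i < thead v ->
              computes h (cons_tuple i (cons_tuple (s i) (behead_tuple v)))
                (s i.+1)
          & y = s (thead v)]
  | RMu _ g => fun v y =>
      computes g (cons_tuple y v) 0 /\
      forall i, i < y -> exists k, computes g (cons_tuple i v) k.+1
  end.

(* Cantor pairing. *)
Definition cpair (x y : nat) : nat := 'C((x + y).+1, 2) + y.

Fixpoint code (a : formula) : nat :=
  match a with
  | Bot => cpair 0 0
  | Top => cpair 1 0
  | Var i => cpair 2 i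
  | Neg b => cpair 3 (code b)
  | Or b c => cpair 4 (cpair (code b) (code c))
  | Dia b c => cpair 5 (cpair (code b) (code c))
  end.

Lemma cpair_inj x y x' y' : cpair x y = cpair x' y' -> x = x' /\ y = y'.
Proof.
rewrite /cpair => e.
have lt_tri a b m n : a + b < m + n ->
    'C((a + b).+1, 2) + b < 'C((m + n).+1, 2) + n.
  move=> ab; apply: (@leq_trans 'C((a + b).+2, 2)).
    by rewrite (binS (a + b).+1) bin1 ltn_add2l ltnS leq_addl.
  by apply: leq_trans (leq_addr _ _); apply: leq_bin2l.
have [ltxy|ltxy|exy] := ltngtP (x + y) (x' + y').
- by have := lt_tri _ _ _ _ ltxy; rewrite e ltnn.
- by have := lt_tri _ _ _ _ ltxy; rewrite e ltnn.
move: e; rewrite exy => /addnI eyy; split=> //.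
by move: exy; rewrite eyy => /addIn.
Qed.

Lemma code_inj : injective code.
Proof.
elim=> [||i|a IHa|a IHa b IHb|a IHa b IHb] [||j|c|c d|c d] //=;
  move=> /cpair_inj[] // _.
- by move=> ->.
- by move=> /IHa ->.
- by move=> /cpair_inj[/IHa -> /IHb ->].
- by move=> /cpair_inj[/IHa -> /IHb ->].
Qed.

(* The set of codes is itself recursive, so leaving [f] unconstrained outside it
   does not change the notion. *)
Definition decidable_set (L : set formula) : Prop :=
  exists f : recfun 1, forall a : formula,
    exists b : bool, computes f [tuple code a] b /\ (L a <-> b).

Definition undecidable (L : set formula) : Prop := ~ decidable_set L.

Local Notation p := (Var 0).
Local Notation q := (Var 1).
Local Notation r := (Var 2).

Definition ax7 : formula := ((p → q) ⊃ ((r → p) → (r → q)))%M.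
Definition ax8 : formula := ((p → q) ⊃ ((q → r) → (p → r)))%M.
Definition ax9 : formula := ((p → q) ∧ (q → r) ⊃ (p → r))%M.
Definition ax10 : formula := (p ∧ (p → q) ⊃ q)%M.

Definition class789 : frame_class := fun W R => forall x y z : W,
  [/\ dot R (dot R [set x] [set y]) [set z]
        `<=` dot R [set x] (dot R [set y] [set z]),
      dot R (dot R [set x] [set y]) [set z]
        `<=` dot R [set y] (dot R [set x] [set z])
    & dot R [set x] [set y] `<=` dot R [set x] (dot R [set x] [set y])].

Definition class7810 : frame_class := fun W R => forall x y z : W,
  [/\ dot R (dot R [set x] [set y]) [set z]
        `<=` dot R [set x] (dot R [set y] [set z]),
      dot R (dot R [set x] [set y]) [set z]
        `<=` dot R [set y] (dot R [set x] [set z])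
    & dot R [set x] [set x] x].

(* Main.v *)
Require Import Defs.
From mathcomp Require Import all_boot finmap.
From mathcomp Require Import boolp classical_sets zify.

(* Both logics are canonical, hence complete for their classes of frames, and as
   [x ∈ x·x] gives [x·y ⊆ (x·x)·y ⊆ x·(x·y)] the second class is contained in the
   first.  A formula describes a tiling of the quarter plane: a point holds a tile,
   [u·h] is the next point of the bottom row and [u·z] the point above [u].  If [h]
   asserts that left multiplication by [h] goes from a tile to one fitting on its
   right, then [(u·h)·z ⊆ h·(u·z)] and [(h·s)·z ⊆ h·(s·z)] carry the column above
   [u·h] over to one above [u], so in the first class the formula forces
   tilings of arbitrarily wide strips.  Conversely a tiling of the quarter plane
   yields a model on finite sets of numbers, with a restricted union as product,
   that lies in the second class.  The space-time diagrams of counter machines are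
   such tilings and a recursive function can be compiled to a counter machine, so
   a recursive decision procedure for any logic between the two would fail on
   the formula of the machine that runs the procedure on its own formula and does
   the opposite. *)

Set Implicit Arguments.
Unset Strict Implicit.
Unset Printing Implicit Defensive.

Local Open Scope classical_set_scope.

(** * Completeness *)

Ltac tautology :=
  let v := fresh "v" in
  move=> v; rewrite /Box /Arrow /And /Imp /=;
  repeat match goal with
  | |- context [truth v ?a] => case: (truth v a) => /=
  | |- context [v ?a] => case: (v a) => /=
  end; by [].

Section Canonical.

Variables (L : set formula) (nL : normal L).

(** Closure under modus ponens only, without substitution or generalization: these are the filters
    of the Lindenbaum algebra of [L]. *)
Definition theory (T : set formula) :=
  L `<=` T /\ forall a b, T (Imp a b) -> T a -> T b.

Definition maximal (T : set formula) :=
  theory T /\ forall a, T (Neg a) <-> ~ T a.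

Section TheoryFacts.
Variables (T : set formula) (thT : theory T).

Lemma theory_L a : L a -> T a. Proof. exact: thT.1. Qed.

Lemma theory_taut a : tautology a -> T a.
Proof. by move=> ta; apply/theory_L/(normal_taut nL). Qed.

Lemma theory_mp a b : T (Imp a b) -> T a -> T b. Proof. exact: thT.2. Qed.

Lemma theory_taut1 a b : tautology (Imp a b) -> T a -> T b.
Proof. by move=> /theory_taut /theory_mp. Qed.

Lemma theory_taut2 a b c : tautology (Imp a (Imp b c)) -> T a -> T b -> T c.
Proof. by move=> /theory_taut /theory_mp Tab /Tab /theory_mp. Qed.

End TheoryFacts.

Lemma theory_logic : theory L.
Proof. by split=> // a b; apply: (normal_mp nL). Qed.

(* A theory maximal among those omitting [a] decides every [b]: the formulas [c]
   with [b ⊃ c] in it form a theory, so if [b] is not in it then [b ⊃ a] is. *)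
Lemma lindenbaum (B : set formula) (a : formula) :
  theory B -> ~ B a -> exists T, [/\ maximal T, B `<=` T & ~ T a].
Proof.
move=> thB nBa.
(* Taking the union with [B] makes the empty chain harmless: its union yields [B] itself. *)
pose P (X : set formula) := theory (B `|` X) /\ ~ (B `|` X) a.
have [F FP totF|X [[thX nXa] maxX]] := @Zorn_bigcup _ P.
  split; last first.
    by case=> // -[X FX Xa]; have [_ []] := FP X FX; right.
  split=> [b Lb|b c]; first by left; apply: theory_L.
  have mpX X : F X -> (B `|` X) (Imp b c) -> (B `|` X) b ->
      (B `|` \bigcup_(X in F) X) c.
    move=> FX bc b'; have [thX _] := FP X FX.
    by case: (theory_mp thX bc b') => [?|?]; [left|right; exists X].
  move=> [Bbc|[X FX Xbc]] [Bb|[Y FY Yb]].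
  - by left; apply: theory_mp Bbc Bb.
  - by apply: (mpX Y) => //; [left|right].
  - by apply: (mpX X) => //; [right|left].
  - have [XY|YX] := totF X Y FX FY.
      by apply: (mpX Y) => //; right => //; apply: XY.
    by apply: (mpX X) => //; right => //; apply: YX.
pose T := B `|` X.
have Tba b : ~ T b -> T (Imp b a).
  move=> nTb; apply: contrapT => nTba.
  have sT : T `<=` [set c | T (Imp b c)].
    by move=> c; apply: (theory_taut1 thX); tautology.
  apply: (maxX [set c | T (Imp b c)]).
    split=> [c Xc|]; first by apply: sT; right.
    move=> /(_ b) Xb; apply: nTb; right; apply: Xb.
    by apply: (theory_taut thX); tautology.
  have eT : B `|` [set c | T (Imp b c)] = [set c | T (Imp b c)].
    by apply/seteqP; split=> c; [case=> // Bc; apply: sT; left|right].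
  rewrite /P eT; split=> //; split=> [c Lc|c d].
    by apply: sT; apply: theory_L.
  by apply: (theory_taut2 thX); tautology.
exists T; split=> // [|b]; last by left.
split=> // b; split=> [Tnb Tb|nTb].
  by apply: nXa; apply: (theory_taut2 thX) Tnb Tb; tautology.
apply: contrapT => nTnb; apply: nXa.
by apply: (theory_taut2 thX) (Tba _ nTb) (Tba _ nTnb); tautology.
Qed.

Section MaximalFacts.
Variables (T : set formula) (mT : maximal T).

Lemma maximal_neg a : T (Neg a) <-> ~ T a. Proof. exact: mT.2. Qed.

Lemma maximal_or a b : T (Or a b) <-> T a \/ T b.
Proof.
have thT := mT.1; split=> [Tab|].
  have [|nTa] := pselect (T a); [by left|right].
  by apply: (theory_taut2 thT) Tab ((maximal_neg a).2 nTa); tautology.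
by case; apply: (theory_taut1 thT); tautology.
Qed.

Lemma maximal_and a b : T a -> T b -> T (And a b).
Proof. by apply: (theory_taut2 mT.1); tautology. Qed.

Lemma maximal_Bot : ~ T Bot.
Proof. by rewrite -maximal_neg; apply: (theory_taut mT.1); tautology. Qed.

End MaximalFacts.

Lemma logic_dual1 a b : L (Imp (Dia a b) (Neg (Box (Neg a) (Neg b)))).
Proof.
exact: (normal_subst nL (fun i => if i is 0 then a else b) (normal_dual1 nL)).
Qed.

Lemma logic_dual2 a b : L (Imp (Neg (Box (Neg a) (Neg b))) (Dia a b)).
Proof.
exact: (normal_subst nL (fun i => if i is 0 then a else b) (normal_dual2 nL)).
Qed.

Lemma logic_K1 a b c :
  L (Imp (Box (Imp a b) c) (Imp (Box a c) (Box b c))).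
Proof.
exact: (normal_subst nL
  (fun i => match i with 0 => a | 1 => b | _ => c end) (normal_K1 nL)).
Qed.

Lemma logic_K2 a b c :
  L (Imp (Box c (Imp a b)) (Imp (Box c a) (Box c b))).
Proof.
exact: (normal_subst nL
  (fun i => match i with 0 => a | 1 => b | _ => c end) (normal_K2 nL)).
Qed.

Section DiaFacts.
Variables (T : set formula) (mT : maximal T).

Let thT : theory T := mT.1.

Lemma maximal_DiaE a b : T (Dia a b) <-> ~ T (Box (Neg a) (Neg b)).
Proof.
rewrite -(maximal_neg mT); split.
  exact: (theory_mp thT (theory_L thT (logic_dual1 a b))).
exact: (theory_mp thT (theory_L thT (logic_dual2 a b))).
Qed.

Lemma maximal_K1 a b c : T (Box (Imp a b) c) -> T (Box a c) -> T (Box b c).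
Proof.
by move=> /(theory_mp thT (theory_L thT (logic_K1 a b c))) /(theory_mp thT).
Qed.

Lemma maximal_K2 a b c : T (Box c (Imp a b)) -> T (Box c a) -> T (Box c b).
Proof.
by move=> /(theory_mp thT (theory_L thT (logic_K2 a b c))) /(theory_mp thT).
Qed.

Lemma maximal_gen1 a b : L a -> T (Box a b).
Proof. by move=> La; apply/(theory_L thT)/(normal_gen1 nL). Qed.

Lemma maximal_gen2 a b : L a -> T (Box b a).
Proof. by move=> La; apply/(theory_L thT)/(normal_gen2 nL). Qed.

Lemma contra_logic a b : L (Imp a b) -> L (Imp (Neg b) (Neg a)).
Proof. by apply: (theory_taut1 theory_logic); tautology. Qed.

Lemma Dia_mono1 a b c : L (Imp a b) -> T (Dia a c) -> T (Dia b c).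
Proof.
move=> Lab; rewrite !maximal_DiaE => nT; apply: contra_not nT.
exact/maximal_K1/maximal_gen1/contra_logic.
Qed.

Lemma Dia_mono2 a b c : L (Imp a b) -> T (Dia c a) -> T (Dia c b).
Proof.
move=> Lab; rewrite !maximal_DiaE => nT; apply: contra_not nT.
exact/maximal_K2/maximal_gen2/contra_logic.
Qed.

Lemma Dia_or1 a b c : T (Dia (Or a b) c) -> T (Dia a c) \/ T (Dia b c).
Proof.
rewrite !maximal_DiaE -not_andE; apply: contra_not => -[Ta Tb].
apply: maximal_K1 Tb; apply: maximal_K1 Ta; apply: maximal_gen1.
by apply: (theory_taut theory_logic); tautology.
Qed.

Lemma Dia_or2 a b c : T (Dia c (Or a b)) -> T (Dia c a) \/ T (Dia c b).
Proof.
rewrite !maximal_DiaE -not_andE; apply: contra_not => -[Ta Tb].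
apply: maximal_K2 Tb; apply: maximal_K2 Ta; apply: maximal_gen2.
by apply: (theory_taut theory_logic); tautology.
Qed.

Lemma Dia_Bot1 a : ~ T (Dia Bot a).
Proof.
rewrite maximal_DiaE => nT; apply: nT; apply: maximal_gen1.
by apply: (theory_taut theory_logic); tautology.
Qed.

Lemma Dia_Bot2 a : ~ T (Dia a Bot).
Proof.
rewrite maximal_DiaE => nT; apply: nT; apply: maximal_gen2.
by apply: (theory_taut theory_logic); tautology.
Qed.

End DiaFacts.

(** The complement of such a set is an ideal of the Lindenbaum algebra of [L]. *)
Definition prime_upset (D : set formula) :=
  [/\ forall a b, L (Imp a b) -> D a -> D b,
      forall a b, D (Or a b) -> D a \/ D b & ~ D Bot].

(** Separation of a filter from a disjoint ideal by an ultrafilter. The set [B] in the proof is the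
    theory generated by [F] and the negations of all formulas outside [D]; if it contained [Bot],
    some member of [F] would lie outside [D]. *)
Lemma prime_extension (F D : set formula) :
  theory F -> prime_upset D -> F `<=` D ->
  exists T, [/\ maximal T, F `<=` T & T `<=` D].
Proof.
move=> thF [upD orD botD] sFD.
have upD' a b : tautology (Imp a b) -> D a -> D b.
  by move=> tab; apply/upD/(normal_taut nL).
pose B := [set d | exists2 g, F g & ~ D (And g (Neg d))].
have thB : theory B.
  split=> [d Ld|d e [g Fg nDg] [h Fh nDh]].
    exists Top; first by apply: (theory_taut thF); tautology.
    apply: contra_not botD; apply: upD.
    by apply: (theory_taut1 theory_logic) Ld; tautology.
  exists (And g h); first by apply: (theory_taut2 thF) Fg Fh; tautology.
  move=> Dghe.
  have : D (Or (And g (Neg (Imp d e))) (And h (Neg d))).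
    by apply: upD' Dghe; tautology.
  by case/orD.
have [[g Fg]|T [mT sBT _]] := lindenbaum thB (a := Bot).
  by apply; apply: upD' (sFD _ Fg); tautology.
exists T; split=> // [d Fd|d Td].
  apply: sBT; exists d => //; apply: contra_not botD; apply: upD'; tautology.
apply: contrapT => nDd; apply/(maximal_neg mT): Td; apply: sBT.
exists Top; first by apply: (theory_taut thF); tautology.
by apply: contra_not nDd; apply: upD'; tautology.
Qed.

Definition world := {T : set formula | maximal T}.

Definition world_set (x : world) : formula -> Prop := sval x.

Coercion world_set : world >-> Funclass.

Lemma worldP (x : world) : maximal (world_set x). Proof. exact: svalP. Qed.

Lemma world_theory (x : world) : theory (world_set x).
Proof. exact: (worldP x).1. Qed.

Definition canonical_rel (x y z : world) :=
  forall a b : formula, y a -> z b -> x (Dia a b).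

Lemma prime_Dia_fixed (x : world) c : prime_upset [set d | x (Dia d c)].
Proof.
split=> [a b|a b|]; have mx := worldP x.
- exact: Dia_mono1.
- exact: Dia_or1.
- exact: Dia_Bot1.
Qed.

Lemma prime_Dia_left (x z : world) :
  prime_upset [set d | forall f, z f -> x (Dia d f)].
Proof.
have mx := worldP x; have mz := worldP z; split=> [a b Lab Da f zf|a b Dab|D].
- exact: Dia_mono1 Lab (Da f zf).
(* If [f] refutes membership of [a] and [g] that of [b], then [f ∧ g] refutes that of [a ∨ b]. *)
- apply: contrapT => /not_orP[/existsNP[f /not_implyP[zf nf]]].
  move=> /existsNP[g /not_implyP[zg ng]].
  have zfg : z (And f g) by apply: maximal_and.
  have weak h : tautology (Imp (And f g) h) -> L (Imp (And f g) h).
    exact: normal_taut.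
  have [/(Dia_mono2 mx (weak f _))|/(Dia_mono2 mx (weak g _))] :=
    Dia_or1 mx (Dab _ zfg).
    by move=> nf'; apply/nf/nf'; tautology.
  by move=> ng'; apply/ng/ng'; tautology.
- apply: (Dia_Bot1 mx (D Top _)).
  by apply: (theory_taut mz.1); tautology.
Qed.

Lemma prime_Dia_right (x y : world) :
  prime_upset [set d | forall f, y f -> x (Dia f d)].
Proof.
have mx := worldP x; have my := worldP y; split=> [a b Lab Da f yf|a b Dab|D].
- exact: Dia_mono2 Lab (Da f yf).
- apply: contrapT => /not_orP[/existsNP[f /not_implyP[yf nf]]].
  move=> /existsNP[g /not_implyP[yg ng]].
  have yfg : y (And f g) by apply: maximal_and.
  have weak h : tautology (Imp (And f g) h) -> L (Imp (And f g) h).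
    exact: normal_taut.
  have [/(Dia_mono1 mx (weak f _))|/(Dia_mono1 mx (weak g _))] :=
    Dia_or2 mx (Dab _ yfg).
    by move=> nf'; apply/nf/nf'; tautology.
  by move=> ng'; apply/ng/ng'; tautology.
- apply: (Dia_Bot2 mx (D Top _)).
  by apply: (theory_taut my.1); tautology.
Qed.

Lemma theory_above b : theory [set d | L (Imp b d)].
Proof.
split=> [a|a c]; first by apply: (theory_taut1 theory_logic); tautology.
by apply: (theory_taut2 theory_logic); tautology.
Qed.

(** The two arguments are found one after the other: first [y] with [c] held fixed, then [z]
    compatible with the whole of [y]. *)
Lemma canonical_exists (x : world) b c : x (Dia b c) ->
  exists y z : world, [/\ canonical_rel x y z, y b & z c].
Proof.
move=> xbc; have mx := worldP x.
have Lid a : L (Imp a a) by apply: (normal_taut nL); tautology.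
have [a Lba|Y [mY sY Yx]] :=
  prime_extension (theory_above b) (prime_Dia_fixed x c).
  exact: Dia_mono1 Lba xbc.
pose y : world := exist _ Y mY.
have [a Lca f /Yx xfc|Z [mZ sZ Zx]] := prime_extension (theory_above c)
    (prime_Dia_right x y).
  exact: Dia_mono2 Lca xfc.
exists y, (exist _ Z mZ); split; [|exact/sY/Lid|exact/sZ/Lid].
by move=> a d ya /Zx; apply.
Qed.

Lemma canonical_truth a (x : world) :
  sat canonical_rel (fun i => [set y : world | y (Var i)]) x a <-> x a.
Proof.
elim: a x => [||i|a IH|a IHa b IHb|a IHa b IHb] x /=; have mx := worldP x.
- by split=> // /(maximal_Bot mx).
- by split=> // _; apply: (theory_taut mx.1); tautology.
- by [].
- by rewrite (maximal_neg mx) IH.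
- by rewrite (maximal_or mx) IHa IHb.
- split=> [[y [z [xyz]]]|/canonical_exists[y [z [xyz ya zb]]]].
    by move=> /IHa ya /IHb; apply: xyz.
  by exists y, z; split=> //; [apply/IHa|apply/IHb].
Qed.

Lemma canonical_complete a : valid canonical_rel a -> L a.
Proof.
move=> va; apply: contrapT => /(lindenbaum theory_logic)[T [mT _ nTa]].
apply: nTa; apply/(canonical_truth a (exist _ T mT)); exact: va.
Qed.

Lemma canonical_mp (x y z : world) a b :
  canonical_rel x y z -> x (Arrow a b) -> y a -> z b.
Proof.
move=> xyz xab ya; apply: contrapT => /(maximal_neg (worldP z)) zb.
by move/(maximal_neg (worldP x)): xab; apply; apply: xyz.
Qed.

(** These are the formulas forced at every point of [y·z]; conversely every maximal theory that
    contains them is a point of [y·z]. *)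
Lemma theory_image (y z : world) :
  theory [set e | exists2 d, z d & y (Arrow d e)].
Proof.
have my := worldP y; have mz := worldP z.
split=> [e Le|d e [f zf yf] [g zg yg]].
  exists Top; first by apply: (theory_taut mz.1); tautology.
  apply/(maximal_neg my) => /(Dia_mono2 my (b := Bot)) yT.
  apply: (Dia_Bot2 my (yT _)).
  by apply: (theory_taut1 theory_logic) Le; tautology.
exists (And f g); first exact: maximal_and.
apply/(maximal_neg my) => yfg.
have : y (Dia (And f g) (Or (Neg (Imp d e)) (Neg d))).
  by apply: Dia_mono2 yfg => //; apply: (normal_taut nL); tautology.
case/(Dia_or2 my) => yd; [move/(maximal_neg my): yf|move/(maximal_neg my): yg].
  by apply; apply: Dia_mono1 yd => //; apply: (normal_taut nL); tautology.
by apply; apply: Dia_mono1 yd => //; apply: (normal_taut nL); tautology.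
Qed.

(** The common core of the canonicity of axioms 7, 8 and 9. The point [n] must extend the theory of
    [y·z] and stay within the formulas that [x] can combine with all of [t]; the hypothesis says
    that the first set lies in the second, and [prime_extension] does the rest. *)
Lemma canonical_compose (x y z t : world) :
  (forall d e f, z d -> t f -> y (Arrow d e) -> ~ x (Arrow e (Neg f))) ->
  exists2 n : world, canonical_rel y z n & canonical_rel x n t.
Proof.
move=> compat; have mx := worldP x; have my := worldP y.
have [e [d zd yde] f tf|N [mN sN Nx]] := prime_extension
    (theory_image y z) (prime_Dia_left x t).
  apply: contrapT => /(maximal_neg mx) nxef; apply: (compat d e f) => //.
  apply/(maximal_neg mx) => xe; move/(maximal_neg mx): nxef; apply.
  by apply: Dia_mono2 xe => //; apply: (normal_taut nL); tautology.
exists (exist _ N mN) => [a b za Nb|a b Na tb]; last exact: Nx.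
apply: contrapT => /(maximal_neg my) nyab.
have /(maximal_neg mN) : N (Neg b); last by apply.
apply: sN; exists a => //; apply/(maximal_neg my) => ya.
move/(maximal_neg my): nyab; apply.
by apply: Dia_mono2 ya => //; apply: (normal_taut nL); tautology.
Qed.

Lemma logic_subst3 a p q r : L a ->
  L (subst (fun i => match i with 0 => p | 1 => q | _ => r end) a).
Proof. exact: normal_subst. Qed.

(** An obstruction would be [d → e] in [y] and [e → ¬f] in [x] with [d] in [z] and [f] in [t]. The
    axiom at [x] then puts [d → ¬f] into [m], hence [¬f] into [t]. *)
Lemma canonical_ax7 (x y z m t : world) : L ax7 ->
  canonical_rel x y m -> canonical_rel m z t ->
  exists2 n : world, canonical_rel y z n & canonical_rel x n t.
Proof.
move=> L7 xym mzt; apply: canonical_compose => d e f zd tf yde xef.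
have /(theory_mp (world_theory x))/(_ xef) :=
  theory_L (world_theory x) (logic_subst3 e (Neg f) d L7).
move=> /(canonical_mp xym)/(_ yde)/(canonical_mp mzt)/(_ zd).
by move/(maximal_neg (worldP t)).
Qed.

Lemma canonical_ax8 (x y z m t : world) : L ax8 ->
  canonical_rel x y m -> canonical_rel m z t ->
  exists2 n : world, canonical_rel x z n & canonical_rel y n t.
Proof.
move=> L8 xym mzt; apply: canonical_compose => d e f zd tf xde yef.
have /(theory_mp (world_theory x))/(_ xde) :=
  theory_L (world_theory x) (logic_subst3 d e (Neg f) L8).
move=> /(canonical_mp xym)/(_ yef)/(canonical_mp mzt)/(_ zd).
by move/(maximal_neg (worldP t)).
Qed.

(** Contraction is the case of [canonical_compose] in which both left factors are [x]. *)
Lemma canonical_ax9 (x y t : world) : L ax9 -> canonical_rel x y t ->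
  exists2 n : world, canonical_rel x y n & canonical_rel x n t.
Proof.
move=> L9 xyt; apply: canonical_compose => d e f yd tf xde xef.
have /(theory_mp (world_theory x)) :=
  theory_L (world_theory x) (logic_subst3 d e (Neg f) L9).
move=> /(_ (maximal_and (worldP x) xde xef))/(canonical_mp xyt)/(_ yd).
by move/(maximal_neg (worldP t)).
Qed.

Lemma canonical_ax10 (x : world) : L ax10 -> canonical_rel x x x.
Proof.
move=> L10 a b xa xb; have mx := worldP x; apply: contrapT.
move=> /(maximal_neg mx) nxab; have xab : x (Arrow a (Neg b)).
  apply/(maximal_neg mx) => xab; move/(maximal_neg mx): nxab; apply.
  by apply: Dia_mono2 xab => //; apply: (normal_taut nL); tautology.
have /(theory_mp (world_theory x)) :=
  theory_L (world_theory x) (logic_subst3 a (Neg b) Bot L10).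
by move=> /(_ (maximal_and mx xa xab))/(maximal_neg mx).
Qed.

End Canonical.

(** * Frame conditions, soundness and completeness of the two logics *)

Lemma dot_pointE W (R : W -> W -> W -> Prop) (x y : W) :
  dot R [set x] [set y] = R x y.
Proof.
apply/seteqP; split=> z; first by case=> _ -> [_ -> ].
by move=> xyz; exists x => //; exists y.
Qed.

Lemma dot_set_pointP W (R : W -> W -> W -> Prop) (X : set W) (z t : W) :
  dot R X [set z] t <-> exists2 m, X m & R m z t.
Proof.
split=> [[m Xm [_ -> mzt]]|[m Xm mzt]]; first by exists m.
by exists m => //; exists z.
Qed.

Lemma dot_point_setP W (R : W -> W -> W -> Prop) (x t : W) (Y : set W) :
  dot R [set x] Y t <-> exists2 n, Y n & R x n t.
Proof.
split=> [[_ -> [n Yn xnt]]|[n Yn xnt]]; first by exists n.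
by exists x => //; exists n.
Qed.

Section FrameConditions.

Variables (W : Type) (R : W -> W -> W -> Prop).

Definition frame_B :=
  forall x y z m t, R x y m -> R m z t -> exists2 n, R y z n & R x n t.
Definition frame_B' :=
  forall x y z m t, R x y m -> R m z t -> exists2 n, R x z n & R y n t.
Definition frame_W := forall x y t, R x y t -> exists2 n, R x y n & R x n t.

Lemma frame_BE : (forall x y z : W, dot R (dot R [set x] [set y]) [set z]
    `<=` dot R [set x] (dot R [set y] [set z])) <-> frame_B.
Proof.
split=> [H x y z m t xym mzt|HB x y z t].
  have /(_ t) := H x y z; rewrite !dot_pointE => Ht.
  by apply/dot_point_setP/Ht/dot_set_pointP; exists m.
rewrite !dot_pointE => /dot_set_pointP[m xym mzt].
exact/dot_point_setP/HB/mzt.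
Qed.

Lemma frame_B'E : (forall x y z : W, dot R (dot R [set x] [set y]) [set z]
    `<=` dot R [set y] (dot R [set x] [set z])) <-> frame_B'.
Proof.
split=> [H x y z m t xym mzt|HB x y z t].
  have /(_ t) := H x y z; rewrite !dot_pointE => Ht.
  by apply/dot_point_setP/Ht/dot_set_pointP; exists m.
rewrite !dot_pointE => /dot_set_pointP[m xym mzt].
exact/dot_point_setP/HB/mzt.
Qed.

Lemma class789E : class789 R <-> [/\ frame_B, frame_B' & frame_W].
Proof.
split=> [H|[/frame_BE HB /frame_B'E HB' HW] x y z].
  split; [apply/frame_BE|apply/frame_B'E|].
  - by move=> x y z; have [] := H x y z.
  - by move=> x y z; have [] := H x y z.
  - move=> x y t xyt; have [_ _ /(_ t)] := H x y y.
    by rewrite !dot_pointE => H9; apply/dot_point_setP/H9.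
by split=> // t; rewrite !dot_pointE => xyt; apply/dot_point_setP/HW.
Qed.

Lemma class7810E :
  class7810 R <-> [/\ frame_B, frame_B' & forall x, R x x x].
Proof.
split=> [H|[/frame_BE HB /frame_B'E HB' HI] x y z].
  split; [apply/frame_BE|apply/frame_B'E|].
  - by move=> x y z; have [] := H x y z.
  - by move=> x y z; have [] := H x y z.
  - by move=> x; have [_ _] := H x x x; rewrite dot_pointE.
by split=> //; rewrite dot_pointE.
Qed.

Lemma sat_And V (w : W) a b :
  sat R V w (And a b) <-> sat R V w a /\ sat R V w b.
Proof. by rewrite /= not_orE !notK. Qed.

Lemma sat_Imp V (w : W) a b :
  sat R V w (Imp a b) <-> (sat R V w a -> sat R V w b).
Proof. by rewrite /= implyE. Qed.

Lemma sat_Arrow V (w : W) a b : sat R V w (Arrow a b) <->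
  forall v u, R w v u -> sat R V v a -> sat R V u b.
Proof.
split=> /= [H v u wvu va|H [v [u [wvu va]]]]; last by apply; apply: H wvu va.
by apply: contrapT => ub; apply: H; exists v, u.
Qed.

End FrameConditions.

Lemma class7810_789 W (R : W -> W -> W -> Prop) :
  class7810 R -> class789 R.
Proof.
rewrite class7810E class789E => -[HB HB' HI]; split=> // x y t.
exact: HB (HI x).
Qed.

Lemma logic_789_7810 : logic_of class789 `<=` logic_of class7810.
Proof. by move=> a La W R /class7810_789; apply: La. Qed.

(** Truth at a fixed point is a propositional valuation with the diamond formulas as atoms, so
    tautologies are valid. *)
Lemma sat_truth W (R : W -> W -> W -> Prop) V w a :
  sat R V w a <-> truth (fun b => `[<sat R V w b>]) a.
Proof.
elim: a => [||i|a IH|a IHa b IHb|a _ b _] //=.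
- by split=> /asboolP.
- by rewrite IH; split=> /negP.
- by rewrite IHa IHb; split=> /orP.
- by split=> /asboolP.
Qed.

Lemma sat_subst W (R : W -> W -> W -> Prop) V s a w :
  sat R V w (subst s a) <->
  sat R (fun i => [set x | sat R V x (s i)]) w a.
Proof.
elim: a w => [||i|a IH|a IHa b IHb|a IHa b IHb] w //=.
- by rewrite IH.
- by rewrite IHa IHb.
- by split=> -[v [u [H /IHa ? /IHb ?]]]; exists v, u.
Qed.

Lemma sat_Box W (R : W -> W -> W -> Prop) V (w : W) a b :
  sat R V w (Box a b) <->
  forall v u, R w v u -> sat R V v a \/ sat R V u b.
Proof.
split=> /= [H v u wvu|H [v [u [/H[va|ub]]]]] //.
by apply: contrapT => /not_orP[nva nub]; apply: H; exists v, u.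
Qed.

Lemma normal_logic_of (C : frame_class) : normal (logic_of C).
Proof.
split.
- by move=> a ta W R _ V w; apply/sat_truth.
- move=> W R _ V w; apply/sat_Imp => /sat_Box H; apply/sat_Imp => /sat_Box G.
  apply/sat_Box => v u wvu; have := G _ _ wvu; have := H _ _ wvu.
  by rewrite sat_Imp; tauto.
- move=> W R _ V w; apply/sat_Imp => /sat_Box H; apply/sat_Imp => /sat_Box G.
  apply/sat_Box => v u wvu; have := G _ _ wvu; have := H _ _ wvu.
  by rewrite sat_Imp; tauto.
- move=> W R _ V w; apply/sat_Imp => -[v [u [wvu va ub]]].
  by move=> /sat_Box Hb; case: (Hb _ _ wvu).
- move=> W R _ V w; apply/sat_Imp => nb; apply: contrapT => nd; apply: nb.
  apply/(@sat_Box _ R V w (Neg (Var 0)) (Neg (Var 1))) => v u wvu /=.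
  by rewrite -not_andE => -[va ub]; apply: nd; exists v, u.
- move=> a b Lab La W R CR V w.
  by have /sat_Imp := Lab W R CR V w; apply; apply: La.
- by move=> s a La W R CR V w; apply/sat_subst/La.
- by move=> a b La W R CR V w; apply/sat_Box => v u _; left; apply: La.
- by move=> a b La W R CR V w; apply/sat_Box => v u _; right; apply: La.
Qed.

Lemma normal_K2_plus Psi : normal (K2_plus Psi).
Proof.
split.
- by move=> a ta L nL _; apply: (normal_taut nL).
- by move=> L nL _; apply: (normal_K1 nL).
- by move=> L nL _; apply: (normal_K2 nL).
- by move=> L nL _; apply: (normal_dual1 nL).
- by move=> L nL _; apply: (normal_dual2 nL).
- by move=> a b Ka Kb L nL sL; apply: (normal_mp nL (Ka L nL sL) (Kb L nL sL)).
- by move=> s a Ka L nL sL; apply/(normal_subst nL)/(Ka L nL sL).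
- by move=> a b Ka L nL sL; apply/(normal_gen1 nL)/(Ka L nL sL).
- by move=> a b Ka L nL sL; apply/(normal_gen2 nL)/(Ka L nL sL).
Qed.

Lemma K2_plus_mem (Psi : set formula) a : Psi a -> K2_plus Psi a.
Proof. by move=> Pa L _; apply. Qed.

Lemma valid_ax7 W (R : W -> W -> W -> Prop) : frame_B R -> valid R ax7.
Proof.
move=> HB V w; rewrite /ax7 /ax8 !sat_Imp !sat_Arrow => H y m wym.
rewrite !sat_Arrow => Hy z t mzt zr.
by have [n yzn wnt] := HB _ _ _ _ _ wym mzt; apply: H wnt (Hy _ _ yzn zr).
Qed.

Lemma valid_ax8 W (R : W -> W -> W -> Prop) : frame_B' R -> valid R ax8.
Proof.
move=> HB V w; rewrite /ax7 /ax8 !sat_Imp !sat_Arrow => H y m wym.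
rewrite !sat_Arrow => Hy z t mzt zr.
by have [n yzn wnt] := HB _ _ _ _ _ wym mzt; apply: Hy wnt (H _ _ yzn zr).
Qed.

Lemma valid_ax9 W (R : W -> W -> W -> Prop) : frame_W R -> valid R ax9.
Proof.
move=> HW V w; rewrite /ax9 sat_Imp sat_And !sat_Arrow => -[H1 H2] y t.
by move=> /HW[n wyn wnt] yp; apply: H2 wnt (H1 _ _ wyn yp).
Qed.

Lemma valid_ax10 W (R : W -> W -> W -> Prop) :
  (forall x, R x x x) -> valid R ax10.
Proof.
move=> HI V w; rewrite /ax10 sat_Imp sat_And sat_Arrow => -[wp].
by apply; [apply: HI|].
Qed.

Lemma K2_plus_789 : K2_plus [set ax7; ax8; ax9] = logic_of class789.
Proof.
have nK := normal_K2_plus [set ax7; ax8; ax9].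
apply/seteqP; split=> a Ka.
  apply: Ka (normal_logic_of _) _ => _ [[]|] -> W R /class789E[HB HB' HW].
  - exact: valid_ax7.
  - exact: valid_ax8.
  - exact: valid_ax9.
apply: (canonical_complete nK); apply: Ka; apply/class789E; split.
- move=> x y z m t; apply: canonical_ax7 => //.
  by apply: K2_plus_mem; left; left.
- move=> x y z m t; apply: canonical_ax8 => //.
  by apply: K2_plus_mem; left; right.
- by move=> x y t; apply: canonical_ax9 => //; apply: K2_plus_mem; right.
Qed.

Lemma K2_plus_7810 : K2_plus [set ax7; ax8; ax10] = logic_of class7810.
Proof.
have nK := normal_K2_plus [set ax7; ax8; ax10].
apply/seteqP; split=> a Ka.
  apply: Ka (normal_logic_of _) _ => _ [[]|] -> W R /class7810E[HB HB' HW].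
  - exact: valid_ax7.
  - exact: valid_ax8.
  - exact: valid_ax10.
apply: (canonical_complete nK); apply: Ka; apply/class7810E; split.
- move=> x y z m t; apply: canonical_ax7 => //.
  by apply: K2_plus_mem; left; left.
- move=> x y z m t; apply: canonical_ax8 => //.
  by apply: K2_plus_mem; left; right.
- by move=> x; apply: canonical_ax10 => //; apply: K2_plus_mem; right.
Qed.

(** * Tilings of the quarter plane as formulas *)

Section FiniteConnectives.

Variable B : finType.

Definition AndOver (P : pred B) (F : B -> formula) : formula :=
  foldr And Top [seq F b | b <- enum P].

Definition OrOver (P : pred B) (F : B -> formula) : formula :=
  foldr Or Bot [seq F b | b <- enum P].

Variables (W : Type) (R : W -> W -> W -> Prop) (V : nat -> set W) (w : W).

Lemma sat_AndOver P F :
  sat R V w (AndOver P F) <-> forall b, P b -> sat R V w (F b).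
Proof.
rewrite /AndOver; transitivity (forall b, b \in enum P -> sat R V w (F b)).
  elim: (enum P) => [|b s IH]; first by split.
  rewrite [foldr _ _ _]/= sat_And IH; split=> [[Fb Fs] c|H].
    by rewrite inE => /predU1P[->|/Fs].
  by split=> [|c cs]; apply: H; rewrite inE ?eqxx ?cs ?orbT.
by split=> H b; move: (H b); rewrite mem_enum.
Qed.

Lemma sat_OrOver P F :
  sat R V w (OrOver P F) <-> exists2 b, P b & sat R V w (F b).
Proof.
rewrite /OrOver; transitivity (exists2 b, b \in enum P & sat R V w (F b)).
  elim: (enum P) => [|b s IH]; first by split=> // -[].
  rewrite /= IH; split=> [[Fb|[c cs Fc]]|[c]].
  - by exists b; rewrite ?inE ?eqxx.
  - by exists c; rewrite ?inE ?cs ?orbT.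
  - by rewrite inE => /predU1P[-> ?|cs Fc]; [left|right; exists c].
by split=> -[b Pb Fb]; exists b => //; move: Pb; rewrite mem_enum.
Qed.

End FiniteConnectives.

Section Tiling.

Variables (A : finType) (Hr Vr : A -> A -> Prop) (start mark : A -> Prop).

(* A tiling of the strip of columns [0, ..., N]. *)
Record tiling (n N : nat) (t : nat -> nat -> A) : Prop := Tiling {
  tiling_start : start (t 0 0);
  tiling_mark : n <= N -> mark (t n 0);
  tiling_right : forall i j, i < N -> Hr (t i j) (t i.+1 j);
  tiling_up : forall i j, i <= N -> Vr (t i j) (t i j.+1)
}.

(* Tiles are paired with the parity of their column: the only trace of
   contraction is that a horizontal step may stay in its column, and the parity
   tells such a step from a proper one. *)
Let B : finType := (A * bool)%type.
Implicit Types b : B.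

Definition right_of b b' := Hr b.1 b'.1 /\ b.2 <> b'.2.
Definition above b b' := Vr b.1 b'.1 /\ b.2 = b'.2.

Definition hstep := Var 0.
Definition vstep := Var 1.
Definition marked := Var 2.
Definition tile_var b := Var (enum_rank b).+3.

Definition tile_is b :=
  And (tile_var b) (AndOver (predC1 b) (fun b' => Neg (tile_var b'))).

Definition tile_in (P : B -> Prop) := OrOver (fun b => `[< P b >]) tile_is.

(** The second disjunct leaves tiles of equal parity unconstrained, since in the model below a left
    factor [[fset a]] may be absorbed. *)
Definition horizontal := AndOver predT (fun b =>
  Arrow (tile_is b) (tile_in (fun b' => right_of b b' \/ b.2 = b'.2))).

Definition grid_point :=
  And (OrOver predT (fun b => And (tile_is b)
         (And (Arrow hstep (tile_in (right_of b)))
              (Arrow vstep (tile_in (above b))))))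
  (And (Imp marked (tile_in (fun b => mark b.1)))
  (And (Dia (And hstep horizontal) Top) (Dia vstep Top))).

(** By [frame_B], the root together with its products is closed under further right multiplication,
    so [Arrow Top] reaches every point of the grid. *)
Definition tiling_formula :=
  And grid_point
    (And (Arrow Top grid_point) (tile_in (fun b => start b.1))).

(** The input enters here and not through the tile set, so that a machine can be run on the code of
    its own tiling formula. *)
Definition input_formula n := iter n (Arrow hstep) marked.

Definition refutation_formula n :=
  Or (Neg tiling_formula) (Neg (input_formula n)).

Section Sat.

Variables (W : Type) (R : W -> W -> W -> Prop) (V : nat -> set W).

Lemma sat_tile_is x b : sat R V x (tile_is b) <->
  V (enum_rank b).+3 x /\ forall b', b' != b -> ~ V (enum_rank b').+3 x.
Proof. by rewrite sat_And sat_AndOver. Qed.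

Lemma tile_is_inj x b c :
  sat R V x (tile_is b) -> sat R V x (tile_is c) -> b = c.
Proof.
rewrite !sat_tile_is => -[Vb _] [_ /(_ b) Vc]; apply/eqP; apply: contrapT.
by move=> /negP /Vc.
Qed.

Lemma sat_tile_in x (P : B -> Prop) :
  sat R V x (tile_in P) <-> exists2 b, P b & sat R V x (tile_is b).
Proof.
by rewrite sat_OrOver; split=> -[b Pb xb]; exists b => //; apply/asboolP.
Qed.

Lemma sat_horizontal h : sat R V h horizontal <-> forall b s t,
  R h s t -> sat R V s (tile_is b) ->
  exists2 b', right_of b b' \/ b.2 = b'.2 & sat R V t (tile_is b').
Proof.
rewrite sat_AndOver; split=> [H b s t hst sb|H b _].
  apply/sat_tile_in; move: (H b isT); rewrite sat_Arrow.
  by apply; first exact: hst.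
by rewrite sat_Arrow => s t hst sb; apply/sat_tile_in/H/sb.
Qed.

Lemma sat_grid_point x : sat R V x grid_point <->
  [/\ exists b, [/\ sat R V x (tile_is b),
        forall h y, R x h y -> V 0 h ->
          exists2 b', right_of b b' & sat R V y (tile_is b') &
        forall z y, R x z y -> V 1 z ->
          exists2 b', above b b' & sat R V y (tile_is b')],
      V 2 x -> exists2 b, mark b.1 & sat R V x (tile_is b),
      exists h y, [/\ R x h y, V 0 h & sat R V h horizontal] &
      exists z y, R x z y /\ V 1 z].
Proof.
rewrite 3!sat_And sat_OrOver sat_Imp sat_tile_in; split.
  move=> [[b _ xb] [xm [[h [y [xhy xh _]]] [z [y' [xzy' xz _]]]]]].
  have /sat_And[{}xh hh] : sat R V h (And hstep horizontal) by [].
  move: xb; rewrite 2!sat_And !sat_Arrow => -[xb [xH xV]].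
  split=> //; [|by exists h, y|by exists z, y'].
  by exists b; split=> // [u v xuv uV|u v xuv uV]; apply/sat_tile_in;
    [apply: xH xuv uV|apply: xV xuv uV].
move=> [[b [xb xH xV]] xm [h [y [xhy xh hh]]] [z [y' [xzy' xz]]]].
split; [exists b => //|split=> //; split].
- rewrite 2!sat_And !sat_Arrow; split=> //.
  by split=> u v xuv uV; apply/sat_tile_in; [apply: xH xuv uV|apply: xV xuv uV].
- have hH : sat R V h (And hstep horizontal) by rewrite sat_And.
  by exists h, y.
- by exists z, y'.
Qed.

End Sat.

(** * From a satisfying point to tilings of strips *)

Section Soundness.

Variables (W : Type) (R : W -> W -> W -> Prop).
Hypotheses (RB : frame_B R) (RB' : frame_B' R).

(* If [y] is a horizontal step [h] away from [x] then a column [c] over [y] is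
   the image under [h] of a column over [x]: the first square is an instance of
   [(x·h)·z ⊆ h·(x·z)], the others of [(h·d)·z ⊆ h·(d·z)]. *)
Lemma shift_column x h y (c z : nat -> W) :
  R x h y -> c 0 = y -> (forall j, R (c j) (z j) (c j.+1)) ->
  exists d : nat -> W, [/\ d 0 = x, forall j, R (d j) (z j) (d j.+1) &
    forall j, R h (d j.+1) (c j.+1)].
Proof.
move=> xhy c0 cz; have := cz 0; rewrite c0 => /(RB' xhy)[d1 xd1 hd1].
have /choice[f fP] : forall p : nat * W, exists e,
    R h p.2 (c p.1.+1) -> R p.2 (z p.1.+1) e /\ R h e (c p.1.+2).
  move=> [j e] /=; have [/RB/(_ (cz j.+1))[e' ee' he']|] :=
    pselect (R h e (c j.+1)); first by exists e'.
  by exists e.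
pose d := fix d j := if j is k.+1 then f (k, d k) else d1.
have hd j : R h (d j) (c j.+1).
  by elim: j => [//|j IH] /=; have [] := fP (j, d j) IH.
exists (fun j => if j is k.+1 then d k else x); split=> // -[//|j] /=.
by have [] := fP (j, d j) (hd j).
Qed.

(** Starting with the column over [u N], each column is carried one place to the left; all of them
    share the vertical steps [z]. *)
Lemma shift_columns (u h : nat -> W) (N : nat) (c z : nat -> W) :
  (forall i, R (u i) (h i) (u i.+1)) -> c 0 = u N ->
  (forall j, R (c j) (z j) (c j.+1)) ->
  exists d : nat -> nat -> W, [/\ d N =1 c, forall i, i <= N -> d i 0 = u i,
    forall i j, i <= N -> R (d i j) (z j) (d i j.+1) &
    forall i j, i < N -> R (h i) (d i j.+1) (d i.+1 j.+1)].
Proof.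
move=> uh; elim: N c => [|N IH] c c0 cz.
  by exists (fun=> c); split=> // i; rewrite leqn0 => /eqP ->.
have [d [d0 dz hd]] := shift_column (uh N) c0 cz.
have [D [DN D0 Dz hD]] := IH d d0 dz.
exists (fun i => if i == N.+1 then c else D i); split=> [j|i iN|i j iN|i j iN].
- by rewrite eqxx.
- by case: eqVneq => [->//|ne]; apply: D0; rewrite -ltnS ltn_neqAle ne.
- by case: eqVneq => // ne; apply: Dz; rewrite -ltnS ltn_neqAle ne.
- rewrite (ltn_eqF iN) eqSS; case: eqVneq => [->|ne]; first by rewrite DN.
  by apply: hD; rewrite ltn_neqAle ne -ltnS.
Qed.

Lemma tiling_of_sat (V : nat -> set W) (w : W) n N :
  sat R V w tiling_formula -> sat R V w (input_formula n) ->
  exists t, tiling n N t.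
Proof.
rewrite /tiling_formula 2!sat_And sat_Arrow sat_tile_in.
move=> [wgrid [allgrid [b0 b0s wb0]]] winput.
pose G x := x = w \/ exists v, R w v x.
have Gstep x y z : G x -> R x y z -> G z.
  move=> [->|[v wvx]] xyz; right; first by exists y.
  by have [m _ wmz] := RB wvx xyz; exists m.
have Ggrid x : G x -> sat R V x grid_point.
  by move=> [->//|[v wvx]]; apply: allgrid wvx _.
have /choice[tl tlP] x : exists b, G x -> sat R V x (tile_is b).
  have [/Ggrid/sat_grid_point[[b [xb _ _]] _ _ _]|] := pselect (G x).
    by exists b.
  by exists b0.
have tl_right x h y : G x -> R x h y -> V 0 h -> right_of (tl x) (tl y).
  move=> Gx xhy hH; have /sat_grid_point[[b [xb xH _]] _ _ _] := Ggrid _ Gx.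
  have [b' bb' yb'] := xH _ _ xhy hH.
  rewrite (tile_is_inj (tlP x Gx) xb).
  by rewrite (tile_is_inj (tlP y (Gstep _ _ _ Gx xhy)) yb').
have tl_up x z y : G x -> R x z y -> V 1 z -> above (tl x) (tl y).
  move=> Gx xzy zV; have /sat_grid_point[[b [xb _ xV]] _ _ _] := Ggrid _ Gx.
  have [b' bb' yb'] := xV _ _ xzy zV.
  rewrite (tile_is_inj (tlP x Gx) xb).
  by rewrite (tile_is_inj (tlP y (Gstep _ _ _ Gx xzy)) yb').
have /choice[H HP] x : exists p : W * W, G x ->
    [/\ R x p.1 p.2, V 0 p.1 & sat R V p.1 horizontal].
  have [/Ggrid/sat_grid_point[_ _ [h [y xhy]] _]|] := pselect (G x).
    by exists (h, y).
  by exists (w, w).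
have /choice[Z ZP] x : exists p : W * W, G x -> R x p.1 p.2 /\ V 1 p.1.
  have [/Ggrid/sat_grid_point[_ _ _ [z [y xzy]]]|] := pselect (G x).
    by exists (z, y).
  by exists (w, w).
(* Only the bottom row [u] and the rightmost column [c] are built from the diamonds; [shift_columns]
   supplies the points in between. *)
pose u i := iter i (fun x => (H x).2) w; pose h i := (H (u i)).1.
have Gu i : G (u i).
  by elim: i => [|i IH]; [left|have [] := HP _ IH; move/(Gstep _ _ _ IH)].
have uh i : R (u i) (h i) (u i.+1) by have [] := HP _ (Gu i).
pose c j := iter j (fun x => (Z x).2) (u N); pose z j := (Z (c j)).1.
have Gc j : G (c j).
  by elim: j => [|j IH]; [apply: Gu|have [] := ZP _ IH; move/(Gstep _ _ _ IH)].
have cz j : R (c j) (z j) (c j.+1) by have [] := ZP _ (Gc j).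
have [d [_ d0 dz hd]] := shift_columns uh (erefl (c 0)) cz.
have Gd i j : i <= N -> G (d i j).
  move=> iN; elim: j => [|j IH]; first by rewrite d0.
  exact: Gstep IH (dz i j iN).
have dup i j : i <= N -> above (tl (d i j)) (tl (d i j.+1)).
  by move=> iN; apply: tl_up (dz i j iN) _; [apply: Gd|have [] := ZP _ (Gc j)].
(* Vertical steps preserve parity, so a column has the parity of its bottom tile and adjacent
   columns differ. *)
have parity i j : i <= N -> (tl (d i j)).2 = (tl (u i)).2.
  move=> iN; elim: j => [|j IH]; first by rewrite d0.
  by have [_ <-] := dup i j iN.
have u_right i : right_of (tl (u i)) (tl (u i.+1)).
  by apply: tl_right (uh i) _; [apply: Gu|have [] := HP _ (Gu i)].
exists (fun i j => (tl (d i j)).1); split.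
- by rewrite d0 //; rewrite (tile_is_inj (tlP w _) wb0) //; left.
- move=> nN; rewrite d0 //.
  have un : V 2 (u n).
    have : forall i, sat R V (u i) (input_formula n) -> V 2 (u (n + i)).
      elim: n {winput nN} => [//|n IH] i; rewrite [input_formula _]/= sat_Arrow.
      have [_ hi _] := HP _ (Gu i).
      by move=> /(_ _ _ (uh i) hi)/IH; rewrite addnS.
    by move/(_ 0 winput); rewrite addn0.
  have /sat_grid_point[_ /(_ un)[b bm ub] _ _] := Ggrid _ (Gu n).
  by rewrite (tile_is_inj (tlP _ (Gu n)) ub).
- move=> i [|j] iN.
    by rewrite (d0 i (ltnW iN)) (d0 i.+1 iN); have [] := u_right i.
  (* Above row 0 the step is a left multiplication by [h i], where [horizontal] offers two cases and
     the parities exclude the second. *)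
  have [_ _ /sat_horizontal hh] := HP _ (Gu i).
  have Gij := Gd i j.+1 (ltnW iN); have Gij' := Gd i.+1 j.+1 iN.
  have [b' + yb'] := hh _ _ _ (hd i j iN) (tlP _ Gij).
  rewrite -(tile_is_inj (tlP _ Gij') yb') => -[[]//|].
  rewrite (parity i _ (ltnW iN)) (parity i.+1 _ iN).
  by have [_ ne] := u_right i.
- by move=> i j iN; have [] := dup i j iN.
Qed.

End Soundness.

(* Only sums of a finite set [x] with a set [y] reaching at least as high are
   defined, and if [y] is a positive singleton, i.e. a step, then it must be
   strictly above [x].  So a step adds a new element to a point containing [0]. *)
Section Model.

Local Open Scope fset_scope.

Definition height (x : {fset nat}) : nat := \max_(i <- x) i.

Definition single (x : {fset nat}) := exists2 a, 0 < a & x = [fset a].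

Definition summable (x y : {fset nat}) :=
  height x <= height y /\ (single y -> height x < height y \/ x = y).

Definition sum_rel (x y z : {fset nat}) := summable x y /\ z = x `|` y.

Lemma height_ge a (x : {fset nat}) : a \in x -> a <= height x.
Proof. by move=> ax; rewrite /height (bigD1_seq a) //= leq_maxl. Qed.

Lemma heightU x y : height (x `|` y) = maxn (height x) (height y).
Proof.
apply/eqP; rewrite eqn_leq geq_max; apply/andP; split.
  apply/bigmax_leqP_seq => i; rewrite in_fsetU => /orP[] ix _.
    by rewrite (leq_trans (height_ge ix)) // leq_maxl.
  by rewrite (leq_trans (height_ge ix)) // leq_maxr.
by apply/andP; split; apply/bigmax_leqP_seq => i ix _; apply: height_ge;
  rewrite in_fsetU ix ?orbT.
Qed.

Lemma height1 a : height [fset a] = a.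
Proof. by rewrite /height big_seq_fset1. Qed.

Lemma height0 : height fset0 = 0.
Proof. by rewrite /height big_seq_fset0. Qed.

Lemma single_setU x y :
  height x <= height y -> single (x `|` y) -> single y.
Proof.
move=> xy [a a0 e]; exists a => //.
have ya : y `<=` [fset a] by rewrite -e fsubsetUr.
move: ya; rewrite fsubset1 => /orP[/eqP//|/eqP y0].
move: (congr1 height e); rewrite heightU height1 (maxn_idPr xy) y0 height0.
by move=> a0'; rewrite -a0' in a0.
Qed.

(** The heights compare by transitivity, so the condition on steps is what matters. It holds if [z]
    is higher than [y], and also if [z] is no step, because a union with [z] on top can be a step
    only if [z] is one. Otherwise [z] equals [x ∪ y], which forces [y = z] and leaves [x] empty or
    equal to [z]. *)
Lemma summable_sum (x y z : {fset nat}) :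
  summable x y -> summable (x `|` y) z ->
  [/\ summable y z, summable x z, summable x (y `|` z) & summable y (x `|` z)].
Proof.
move=> [xy _]; rewrite /summable !heightU (maxn_idPr xy) => -[yz sz].
have xz := leq_trans xy yz; rewrite (maxn_idPr xz) (maxn_idPr yz).
have [lt|ge] := ltnP (height y) (height z).
  have ltx := leq_ltn_trans xy lt.
  by split; split=> // _; left.
have [s1|ns] := pselect (single z); last first.
  by split; split=> // /single_setU sU; case: ns; apply: sU.
have {sz} e : x `|` y = z by case: (sz s1) => //; rewrite ltnNge ge.
have [a a0 za] := s1.
have ey : y = z.
  have : y `<=` [fset a] by rewrite -za -e fsubsetUr.
  rewrite fsubset1 -za => /orP[/eqP//|/eqP y0].
  by move: ge; rewrite y0 height0 za height1 leqNgt a0.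
have xz' : height x < height z \/ x = z.
  have : x `<=` [fset a] by rewrite -za -e fsubsetUl.
  rewrite fsubset1 -za => /orP[/eqP|/eqP ->]; first by right.
  by left; rewrite height0 za height1.
have -> : x `|` z = z by rewrite -e fsetUA fsetUid.
rewrite ey fsetUid; split; split=> //; by right.
Qed.

Lemma class7810_sum_rel : class7810 sum_rel.
Proof.
apply/class7810E.
split=> [x y z m t [xy ->] [xyz ->]|x y z m t [xy ->] [xyz ->]|x].
- have [yz _ xyz' _] := summable_sum xy xyz.
  by exists (y `|` z); split=> //; rewrite fsetUA.
- have [_ xz _ yxz] := summable_sum xy xyz.
  by exists (x `|` z); split=> //; rewrite fsetUCA fsetUA.
- by split; [split=> // _; right|rewrite fsetUid].
Qed.

Definition count_in (P : pred nat) (x : {fset nat}) : nat := \sum_(i <- x) P i.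

Lemma count_inU1 P a x :
  a \notin x -> count_in P (a |` x) = (P a + count_in P x)%N.
Proof. by move=> ax; rewrite /count_in big_fsetU1. Qed.

Definition positive_even i := ~~ odd i && (0 < i).

Variables (n : nat) (t : nat -> nat -> A).
Hypothesis tP : forall N, tiling n N t.

(** Odd elements count horizontal steps and positive even elements vertical ones. The element [0]
    marks grid points, so the steps themselves hold no tile. *)
Definition model_tile (x : {fset nat}) : B :=
  (t (count_in odd x) (count_in positive_even x), odd (count_in odd x)).

Definition model_val (k : nat) : set {fset nat} :=
  match k with
  | 0 => [set x | exists2 a, odd a & x = [fset a]]
  | 1 => [set x | exists2 a, positive_even a & x = [fset a]]
  | 2 => [set x | 0 \in x /\ mark (model_tile x).1]
  | i.+3 => [set x | 0 \in x /\ i = enum_rank (model_tile x)]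
  end.

Let msat := sat sum_rel model_val.

Lemma model_tileP x b : msat x (tile_is b) <-> 0 \in x /\ b = model_tile x.
Proof.
rewrite /msat sat_tile_is /=; split=> [[[x0 e] _]|[x0 ->]].
  by split=> //; apply: enum_rank_inj; apply: val_inj.
split=> // b' /eqP ne [_ e]; apply: ne; apply: enum_rank_inj; exact: val_inj.
Qed.

Lemma step_new a x y : 0 < a -> 0 \in x -> sum_rel x [fset a] y ->
  a \notin x /\ y = a |` x.
Proof.
move=> a0 x0 [[_ sxa] ->]; rewrite fsetUC; split=> //.
case: sxa => [|xa|ex].
- by exists a.
- by apply: contraL xa => /height_ge; rewrite height1 -leqNgt.
- by move: x0; rewrite ex inE => /eqP a00; rewrite -a00 in a0.
Qed.

Lemma step_above x a : height x < a -> sum_rel x [fset a] (x `|` [fset a]).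
Proof.
by move=> xa; split=> //; rewrite /summable height1; split; [apply: ltnW|left].
Qed.

Lemma model_right a x : odd a -> a \notin x ->
  right_of (model_tile x) (model_tile (a |` x)).
Proof.
move=> oa ax; rewrite /model_tile !count_inU1 // /positive_even oa /=.
rewrite add0n add1n.
split=> /=; last by move=> e; case: (odd _) e.
exact: tiling_right (tP (count_in odd x).+1) _ _ (ltnSn _).
Qed.

Lemma model_above a x : positive_even a -> a \notin x ->
  above (model_tile x) (model_tile (a |` x)).
Proof.
move=> ea ax; have /andP[oa _] := ea.
rewrite /model_tile !count_inU1 // ea (negPf oa) /= add0n add1n.
split=> //=; exact: tiling_up (tP (count_in odd x)) _ _ (leqnn _).
Qed.

Lemma model_horizontal a : odd a -> msat [fset a] horizontal.
Proof.
move=> oa; apply/sat_horizontal => b s _ [_ ->] /model_tileP[s0 ->].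
exists (model_tile (a |` s)); last first.
  by apply/model_tileP; rewrite in_fsetU s0 orbT.
have [/mem_fset1U ->|/(model_right oa)] := boolP (a \in s); first by right.
by left.
Qed.

Lemma model_grid_point x : 0 \in x -> msat x grid_point.
Proof.
move=> x0; have xt : msat x (tile_is (model_tile x)) by apply/model_tileP.
have y0 a : 0 \in a |` x by rewrite in_fsetU x0 orbT.
apply/sat_grid_point; split.
- exists (model_tile x); split=> // h y xhy [a pa ea]; rewrite {h}ea in xhy.
    have [ax ->] := step_new (odd_gt0 pa) x0 xhy.
    by exists (model_tile (a |` x)); [apply: model_right|apply/model_tileP].
  have /andP[_ a0] := pa; have [ax ->] := step_new a0 x0 xhy.
  by exists (model_tile (a |` x)); [apply: model_above|apply/model_tileP].
- by move=> [_ mx]; exists (model_tile x).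
(* A step has to lie strictly above [x]; doubling the height lets the parity be chosen, odd here and
   even for the vertical step. *)
- pose a := (height x).*2.+1.
  have oa : odd a by rewrite /a /= odd_double.
  exists [fset a], (x `|` [fset a]).
  split; [|by exists a|exact: model_horizontal].
  by apply: step_above; rewrite ltnS -addnn leq_addr.
- pose a := (height x).*2.+2.
  exists [fset a], (x `|` [fset a]); split; last first.
    by exists a => //; rewrite /positive_even /a /= odd_double.
  by apply: step_above; rewrite ltnS -addnn leqW ?leq_addr.
Qed.

(** After horizontal steps only, a point lies in row 0 in the column given by its number of odd
    elements; [m] more steps lead to column [n]. *)
Lemma model_input m x : 0 \in x -> count_in positive_even x = 0 ->
  (count_in odd x + m)%N = n -> msat x (input_formula m).
Proof.
elim: m x => [|m IH] x x0 ex.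
  rewrite addn0 => ox; split=> //; rewrite /model_tile ex ox.
  exact: tiling_mark (tP n) (leqnn n).
move=> oxm; rewrite /msat [input_formula _]/= sat_Arrow => h y xhy [a oa ea].
rewrite {h}ea in xhy; have [ax ->] := step_new (odd_gt0 oa) x0 xhy.
apply: IH; first by rewrite in_fsetU x0 orbT.
  by rewrite count_inU1 // /positive_even oa ex.
by rewrite count_inU1 // oa -oxm addnS.
Qed.

Lemma sat_of_tiling : ~ logic_of class7810 (refutation_formula n).
Proof.
move=> /(_ _ _ class7810_sum_rel model_val [fset 0]).
have c0 P : P 0 = false -> count_in P [fset 0] = 0.
  by move=> P0; rewrite /count_in big_seq_fset1 P0.
have z0 : 0 \in [fset 0] by rewrite inE.
have psi : msat [fset 0] tiling_formula.
  rewrite /msat /tiling_formula 2!sat_And sat_Arrow sat_tile_in; split.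
    exact: model_grid_point.
  split=> [y x [_ ->] _|].
    by apply: model_grid_point; rewrite in_fsetU z0.
  exists (model_tile [fset 0]); last exact/model_tileP.
  by rewrite /model_tile !c0 //; apply: tiling_start (tP 0).
by case; apply=> //; apply: model_input; rewrite ?c0.
Qed.

End Model.

Lemma logic_of_no_tiling n N :
  ~ (exists t, tiling n N t) -> logic_of class789 (refutation_formula n).
Proof.
move=> nt W R /class789E[RB RB' _] V w; apply/sat_Imp => psi input.
exact/nt/(tiling_of_sat RB RB' _ psi input).
Qed.

End Tiling.

(** * Space-time diagrams of counter machines *)

Inductive instr (S : Type) := Incr of nat & S | Decr of nat & S & S.

Definition instr_map S T (f : S -> T) (i : instr S) : instr T :=
  match i with
  | Incr k q => Incr k (f q)
  | Decr k q1 q2 => Decr k (f q1) (f q2)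
  end.

Definition register S (i : instr S) :=
  match i with Incr k _ | Decr k _ _ => k end.

Definition update (r : nat -> nat) k v : nat -> nat :=
  fun i => if i == k then v else r i.

Section Machine.

Variables (S : Type) (prog : S -> instr (option S)).

Definition config := (option S * (nat -> nat))%type.

(* The state [None] is the halting state. *)
Definition step (c : config) : config :=
  if c.1 isn't Some q then c else
  match prog q with
  | Incr k q' => (q', update c.2 k (c.2 k).+1)
  | Decr k q1 q2 =>
      if c.2 k is m.+1 then (q1, update c.2 k m) else (q2, c.2)
  end.

Definition run (q : option S) (r : nat -> nat) j := iter j step (q, r).

Lemma run_halted r j : run None r j = (None, r).
Proof. by elim: j => //= j ->. Qed.

End Machine.

Section SpaceTime.

Variables (S : finType) (prog : S -> instr (option S)) (q0 : S).

Let K := (\max_q register (prog q)).+1.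

Definition state_register (q : S) : 'I_K := inord (register (prog q)).

Lemma state_registerE q : state_register q = register (prog q) :> nat.
Proof. by rewrite inordK // ltnS (leq_bigmax q). Qed.

(* The tile at column [i] and row [j] holds the state at time [j], whether its
   register is then 0, whether [i = 0], whether column [i - 1] is below the value
   of register 0 (vacuously if [i = 0]), and the sets of registers whose values
   at times [j] and [j + 1] exceed [i]. *)
Definition tile : finType :=
  (option S * bool * bool * bool * {ffun 'I_K -> bool} *
   {ffun 'I_K -> bool})%type.
Implicit Types a b : tile.

Definition t_state a := a.1.1.1.1.1.
Definition t_zero a := a.1.1.1.1.2.
Definition t_first a := a.1.1.1.2.
Definition t_left a := a.1.1.2.
Definition t_now a := a.1.2.
Definition t_next a := a.2.

(** Registers are written in unary along a row. An increment shifts the indicator of its register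
    one column to the right, with a true entry coming in at column 0, and a decrement of a positive
    register shifts it to the left. Demanding a state [Some q] makes a halted row impossible. *)
Definition t_right a b :=
  [/\ t_state a = t_state b, t_zero a = t_zero b, ~~ t_first b,
      t_left b = t_now a ord0 &
      forall k, t_now b k -> t_now a k] /\
  exists q, [/\ t_state a = Some q, (t_first a -> t_left a),
    forall k, k != state_register q -> t_next a k = t_now a k &
    let k := state_register q in
    match prog q with
    | Incr _ _ =>
        (t_first a -> t_next a k) /\ t_next b k = t_now a k
    | Decr _ _ _ =>
        (t_first a -> t_zero a = ~~ t_now a k) /\
        t_next a k = t_now (if t_zero a then a else b) k
    end].

Definition next_state (o : option S) (z : bool) :=
  if o is Some q then
    match prog q with
    | Incr _ q' => q'
    | Decr _ q1 q2 => if z then q2 else q1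
    end
  else None.

Definition t_above a b :=
  [/\ t_first b = t_first a, t_now b = t_next a &
      t_state b = next_state (t_state a) (t_zero a)].

(** Register 0 is left open because the mark fixes its value. For the others column 0 suffices, as
    [t_right] makes [t_now] decreasing along a row. *)
Definition t_start a :=
  [/\ t_state a = Some q0, t_first a &
      forall k, k != ord0 -> ~~ t_now a k].

(* In row 0 this holds exactly at the column given by the value of register 0. *)
Definition t_mark a := t_left a /\ ~~ t_now a ord0.

Definition input n := update (fun=> 0) 0 n.

Let c n j := run prog (Some q0) (input n) j.

Lemma step_register (d : config S) q k : d.1 = Some q ->
  k != register (prog q) -> (step prog d).2 k = d.2 k.
Proof.
rewrite /step => ->; case: (prog q) => [m q'|m q1 q2] /negPf /= km.
  by rewrite /update km.
by case: (d.2 m) => //= v; rewrite /update km.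
Qed.

Lemma tiling_of_run n : (forall j, (c n j).1 <> None) ->
  exists t, forall N, tiling t_right t_above t_start t_mark n N t.
Proof.
move=> alive; pose v j k := (c n j).2 k.
have [s sP] : exists s : nat -> S, forall j, (c n j).1 = Some (s j).
  exists (fun j => odflt q0 (c n j).1) => j.
  by case: ((c n j).1) (alive j).
pose zero j := v j (register (prog (s j))) == 0.
pose bits i j : {ffun 'I_K -> bool} := [ffun k : 'I_K => i < v j k].
exists (fun i j => (Some (s j), zero j, i == 0, i <= v j 0,
                    bits i j, bits i j.+1)) => N; split.
- split=> //= [|k k0]; first by have := sP 0; rewrite /c /= => -[<-].
  by move: k0; rewrite -val_eqE ffunE /v /c /= /input /update => /negPf ->.
- move=> nN; rewrite /t_mark /t_left /t_now /= ffunE.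
  by rewrite /v /c /= /input /update eqxx leqnn ltnn.
- move=> i j iN; split.
    split=> //= [|k]; first by rewrite ffunE.
    by rewrite !ffunE; apply: ltn_trans.
  exists (s j); split=> //=; first by move=> /eqP ->.
    move=> k; rewrite -val_eqE /= state_registerE => ks; rewrite !ffunE.
    by congr (_ < _); apply: step_register (sP j) _.
  have vS k : v j.+1 k = (step prog (c n j)).2 k by [].
  rewrite /t_next /t_now /t_zero /t_first /= !ffunE !vS state_registerE.
  rewrite {vS} /zero /step sP /v.
  case E: (prog (s j)) => [k q|k q1 q2] /=.
    by rewrite /update eqxx; split=> // i0; rewrite (eqP i0).
  have kE : state_register (s j) = k :> nat by rewrite state_registerE E.
  split=> [i0|]; first by rewrite (eqP i0); case: ((c n j).2 k).
  case Ec: ((c n j).2 k) => [|m] /=; rewrite ffunE /v kE Ec //.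
  by rewrite /update eqxx.
- move=> i j iN; split=> //=.
  have := sP j.+1; rewrite (_ : c n j.+1 = step prog (c n j)) // /step sP.
  rewrite /zero /v; case: (prog (s j)) => [k q|k q1 q2] /=; first by move=> ->.
  by case: ((c n j).2 k).
Qed.

(** A decrement reads the column to its right, so a tiling is known to follow the run only where
    [i + j <= N]. The width covers the marked column [n] and, in row [M], column 0 with a right
    neighbour, which [t_right] forbids in the halting state. *)
Lemma no_tiling_of_halting n M : (c n M).1 = None ->
  ~ exists t, tiling t_right t_above t_start t_mark n (M + n).+1 t.
Proof.
set N := (M + n).+1 => halted [t [[ts tf t0] tm tr tu]].
have first i j : i <= N -> t_first (t i j) = (i == 0).
  case: i => [|i] iN; last by have [[_ _ /negPf-> _ _] _] := tr i j iN.
  by elim: j => [|j IH]; [rewrite tf|have [-> _ _] := tu 0 j iN].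
have state0 i : i <= N -> t_state (t i 0) = Some q0.
  elim: i => [//|i IH] iN; have [[<- _ _ _ _] _] := tr i 0 iN.
  exact/IH/ltnW.
have sub i i' k : i <= i' -> i' <= N -> t_now (t i' 0) k -> t_now (t i 0) k.
  elim: i' => [|i' IH]; first by rewrite leqn0 => /eqP ->.
  rewrite leq_eqVlt => /predU1P[->|]; [by []|rewrite ltnS => ii' iN].
  have [[_ _ _ _ s1] _] := tr i' 0 iN.
  by move=> /s1; apply: IH => //; apply: ltnW.
have nN : n <= N by rewrite /N ltnW // ltnS leq_addl.
have [l nm] := tm nN.
(* The mark bounds register 0 on both sides: column [n] is not below its value, and by [t_left]
   column [n - 1] is. *)
have now0 i (k : 'I_K) : i <= N -> t_now (t i 0) k = (i < input n k).
  move=> iN; rewrite /input /update; have [k0|k0] := eqVneq k ord0; last first.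
    move: (k0); rewrite -val_eqE /= => /negPf ->.
    by apply: contraNF (t0 k k0); apply: sub.
  rewrite k0 /=; have [lt|ge] := ltnP i n; last first.
    by apply: contraNF nm; apply: sub.
  have n0 : 0 < n := leq_ltn_trans (leq0n i) lt.
  have n1 : n.-1 < N by rewrite prednK.
  apply: (sub i n.-1); [by case: (n) lt|exact: ltnW|].
  have [[_ _ _ <- _] _] := tr n.-1 0 n1.
  by rewrite prednK.
have zeroE i j : i <= N -> t_zero (t i j) = t_zero (t 0 j).
  elim: i => [//|i IH] iN; have [[_ <- _ _ _] _] := tr i j iN.
  exact/IH/ltnW.
have spec j : forall i, i + j <= N ->
    t_state (t i j) = (c n j).1 /\
    forall k : 'I_K, t_now (t i j) k = (i < (c n j).2 k).
  elim: j => [|j IH] i.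
    by rewrite addn0 => iN; split=> [|k]; [apply: state0|apply: now0].
  rewrite addnS => ijN; have iN : i < N := leq_ltn_trans (leq_addr _ _) ijN.
  have [st nw] := IH i (ltnW ijN).
  have [_ [q [sq _ other touched]]] := tr i j iN.
  have [_ nw' st'] := tu i j (ltnW iN).
  move: st; rewrite sq => /esym cq.
  have [st0 nw0] := IH 0 (ltnW (leq_ltn_trans (leq_addl i j) ijN)).
  have [_ [q1 []]] := tr 0 j isT.
  rewrite st0 cq => -[<-] _ _ /= touched0 {q1 st0}.
  have kE := state_registerE q.
  rewrite st' sq nw'.
  have step_now : t_next (t i j) (state_register q) =
        (i < (step prog (c n j)).2 (register (prog q))) ->
      forall k : 'I_K, t_next (t i j) k = (i < (step prog (c n j)).2 k).
    move=> nxk k; have [->|ne] := eqVneq k (state_register q).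
      by rewrite nxk kE.
    by rewrite other // nw (step_register cq) // -kE.
  move: touched touched0 step_now.
  rewrite (zeroE i j (ltnW iN)) !first ?(ltnW iN) //.
  rewrite /next_state /step cq nw0 kE.
  case E: (prog q) => [m q'|m q1 q2] /= [tl tr'] [tl0 _] sn.
    split=> //; apply: sn; rewrite /update eqxx.
    (* The new entry in column [i] is governed by the rule between columns [i - 1] and [i], and in
       column 0 by [t_first]. *)
    case: (i) iN ijN tl => [|i1] iN' ijN' tl1; first exact: tl1.
    have [_ [q2 []]] := tr i1 j (ltnW iN').
    have [-> nw1] := IH i1 (ltnW (ltnW ijN')).
    rewrite cq => -[<-] _ _; rewrite E /= => -[_ ->].
    by rewrite nw1 kE E.
  move: tr' sn; rewrite tl0 // => tr'.
  case Ec: ((c n j).2 m) tr' => [|v] /= tr' sn; split=> //; apply: sn.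
    by rewrite tr' nw kE E.
  rewrite tr'; have [_ ->] := IH i.+1 ijN.
  by rewrite kE E /= Ec /update eqxx.
have [s0 _] := spec M 0 (leqW (leq_addr n M)).
by have [_ [q []]] := tr 0 M isT; rewrite s0 halted.
Qed.

End SpaceTime.

(** A machine placed inside a larger one along [e], with its halting redirected to [x]: its steps
    are mirrored until the one that leaves. *)
Lemma run_embed S S' (prog : S -> instr (option S))
    (prog' : S' -> instr (option S')) (e : S -> S') (x : option S') q r j r' :
  (forall q, prog' (e q) =
     instr_map (fun o => if o is Some q then Some (e q) else x) (prog q)) ->
  run prog (Some q) r j = (None, r') ->
  exists j', run prog' (Some (e q)) r j' = (x, r').
Proof.
move=> pe; elim: j q r => [//|j IH] q r; rewrite /run iterSr.
pose g o := if o is Some q then Some (e q) else x.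
have : step prog' (Some (e q), r) =
    (g (step prog (Some q, r)).1, (step prog (Some q, r)).2).
  rewrite /step /= pe; case: (prog q) => [k q'|k q1 q2] //=.
  by case: (r k).
case: (step prog _) => -[q1|] r1 /= e1.
  by move=> /IH[j' ej]; exists j'.+1; rewrite /run iterSr e1.
rewrite -/(run _ _ _ _) run_halted => -[<-]; exists 1.
by rewrite /run /= e1.
Qed.

Lemma runD S (prog : S -> instr (option S)) q r j q' r' j' :
  run prog q r j = (q', r') -> run prog q r (j + j') = run prog q' r' j'.
Proof. by rewrite /run addnC iterD => ->. Qed.

(** * While programs as counter machines *)

Inductive cmd := Inc of nat | Seq of cmd & cmd | Loop of nat & cmd.

Fixpoint cmd_state (p : cmd) : finType :=
  match p with
  | Inc _ => unit
  | Seq p1 p2 => (cmd_state p1 + cmd_state p2)%type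
  | Loop _ p => option (cmd_state p)
  end.

Fixpoint cmd_entry (p : cmd) : cmd_state p :=
  match p return cmd_state p with
  | Inc _ => tt
  | Seq p1 _ => inl (cmd_entry p1)
  | Loop _ _ => None
  end.

(* [Loop k p] is: while register [k] is positive, decrement it and do [p].  Its
   state [None] is the test, to which leaving [p] returns. *)
Fixpoint cmd_instr (p : cmd) : cmd_state p -> instr (option (cmd_state p)) :=
  match p return cmd_state p -> instr (option (cmd_state p)) with
  | Inc k => fun _ => Incr k None
  | Seq p1 p2 => fun q =>
      match q with
      | inl q => instr_map
          (fun o => if o is Some q' then Some (inl q')
                    else Some (inr (cmd_entry p2)))
          (cmd_instr q)
      | inr q => instr_map (omap inr) (cmd_instr q)
      end
  | Loop k p => fun q =>
      if q is Some q then instr_map Some (cmd_instr q)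
      else Decr k (Some (Some (cmd_entry p))) None
  end.

Definition exec (p : cmd) (r r' : nat -> nat) :=
  exists j, run (@cmd_instr p) (Some (cmd_entry p)) r j = (None, r').

Lemma exec_Inc k r : exec (Inc k) r (update r k (r k).+1).
Proof. by exists 1. Qed.

Lemma exec_Seq p1 p2 r1 r2 r3 :
  exec p1 r1 r2 -> exec p2 r2 r3 -> exec (Seq p1 p2) r1 r3.
Proof.
move=> [j1 e1] [j2 e2].
have [|j1' e1'] := run_embed (prog' := @cmd_instr (Seq p1 p2)) (e := inl)
  (x := Some (inr (cmd_entry p2))) _ e1; first by [].
have [|j2' e2'] := run_embed (prog' := @cmd_instr (Seq p1 p2)) (e := inr)
  (x := None) _ e2; first by move=> q /=; case: (cmd_instr q).
by exists (j1' + j2')%N; rewrite (runD _ e1').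
Qed.

Lemma run_Loop k p r r' m : r k = m.+1 -> exec p (update r k m) r' ->
  exists j, run (@cmd_instr (Loop k p)) (Some None) r j.+1 = (Some None, r').
Proof.
move=> rk [j e].
have [|j' e'] := run_embed (prog' := @cmd_instr (Loop k p)) (e := Some)
  (x := Some None) _ e.
  by move=> q /=; case: (cmd_instr q) => [? []|? [?|] []].
exists j'; have e1 : run (@cmd_instr (Loop k p)) (Some None) r 1 =
    (Some (Some (cmd_entry p)), update r k m).
  by rewrite /run /= /step /= rk.
by rewrite -add1n (runD _ e1).
Qed.

Lemma exec_Loop0 k p r : r k = 0 -> exec (Loop k p) r r.
Proof. by move=> rk; exists 1; rewrite /run /= /step /= rk. Qed.

Lemma exec_LoopS k p r r1 r2 m : r k = m.+1 ->
  exec p (update r k m) r1 -> exec (Loop k p) r1 r2 -> exec (Loop k p) r r2.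
Proof.
move=> rk /(run_Loop rk)[j e] [j' e'].
by exists (j.+1 + j')%N; rewrite (runD _ e).
Qed.

(** * Compilation of recursive functions *)

(** The store after [i] passes is [s i], and the body starts from it with the counter already
    decremented. *)
Lemma exec_for k p m (s : nat -> nat -> nat) :
  (forall i, i <= m -> s i k = m - i) ->
  (forall i, i < m -> exec p (update (s i) k (m - i.+1)) (s i.+1)) ->
  exec (Loop k p) (s 0) (s m).
Proof.
elim: m s => [|m IH] s sk sp; first by apply: exec_Loop0; rewrite sk.
apply: (@exec_LoopS k p _ (s 1) _ m); first by rewrite sk.
  by have := sp 0 isT; rewrite subSS subn0.
apply: (IH (fun i => s i.+1)) => i im; first by rewrite sk.
by have := sp i.+1 im; rewrite subSS.
Qed.

Lemma update_id r k v : r k = v -> update r k v = r.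
Proof.
by move=> rk; apply/funext => x; rewrite /update; case: eqVneq => [->|].
Qed.

(** With no empty command at hand, a loop on a register known to be zero stands in for one, also as
    the body of [clear]. *)
Definition skip k := Loop k (Inc k).
Definition clear k t := Loop k (skip t).
Definition move k l := Loop k (Inc l).
(** Reading a register empties it, so its value is saved in [t] and moved back. *)
Definition copy k l t := Seq (Loop k (Seq (Inc l) (Inc t))) (move t k).

Lemma exec_skip k r : r k = 0 -> exec (skip k) r r.
Proof. exact: exec_Loop0. Qed.

Ltac update_ext :=
  apply/funext => x; rewrite /update;
  repeat (let e := fresh "e" in case: eqVneq => e; rewrite ?e ?eqxx //=);
  try lia.

Lemma exec_clear k t r : k != t -> r t = 0 -> exec (clear k t) r (update r k 0).
Proof.
move=> kt rt; pose s i := update r k (r k - i).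
have -> : update r k 0 = s (r k) by rewrite /s subnn.
have {1}-> : r = s 0 by rewrite /s subn0 update_id.
apply: exec_for => i _; first by rewrite /s /update eqxx.
have -> : update (s i) k (r k - i.+1) = s i.+1 by rewrite /s; update_ext.
by apply: exec_skip; rewrite /s /update eq_sym (negPf kt).
Qed.

Lemma exec_move k l r : k != l ->
  exec (move k l) r (update (update r l (r l + r k)) k 0).
Proof.
move=> kl; pose s i := update (update r l (r l + i)) k (r k - i).
have -> : update (update r l (r l + r k)) k 0 = s (r k) by rewrite /s subnn.
have {1}-> : r = s 0 by rewrite /s addn0 subn0; update_ext.
apply: exec_for => i _; first by rewrite /s /update eqxx.
set r' := update _ _ _.
have -> : s i.+1 = update r' l (r' l).+1 by rewrite /r' /s; update_ext.
exact: exec_Inc.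
Qed.

Lemma exec_copy k l t r : k != l -> k != t -> l != t -> r t = 0 ->
  exec (copy k l t) r (update r l (r l + r k)).
Proof.
move=> kl kt lt rt.
pose s i := update (update (update r t i) l (r l + i)) k (r k - i).
apply: (@exec_Seq _ _ _ (s (r k))).
  have {1}-> : r = s 0.
    by rewrite /s addn0 subn0; update_ext.
  apply: exec_for => i _; first by rewrite /s /update eqxx.
  set r' := update _ _ _; apply: exec_Seq (exec_Inc _ _) _.
  set r'' := update _ _ _.
  have -> : s i.+1 = update r'' t (r'' t).+1.
    by rewrite /r'' /r' /s; update_ext.
  exact: exec_Inc.
have -> : update r l (r l + r k) =
    update (update (s (r k)) k (s (r k) k + s (r k) t)) t 0.
  by rewrite /s; update_ext.
by apply: exec_move; rewrite eq_sym.
Qed.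

(* The registers from [b] on hold [l]; all later ones are [0], the default of
   [nth]. *)
Definition scratch b (r : nat -> nat) (l : seq nat) : nat -> nat :=
  fun x => if x < b then r x else nth 0 l (x - b).

Lemma scratch_nil b r : (forall k, b <= k -> r k = 0) -> scratch b r [::] = r.
Proof.
move=> r0; apply/funext => x; rewrite /scratch nth_nil.
by case: ltnP => // /r0.
Qed.

Lemma scratchD b r l i : scratch b r l (b + i) = nth 0 l i.
Proof. by rewrite /scratch ltnNge leq_addr addKn. Qed.

Lemma scratch_low b r l k : k < b -> scratch b r l k = r k.
Proof. by rewrite /scratch => ->. Qed.

Lemma scratch_high b r l k : b + size l <= k -> scratch b r l k = 0.
Proof.
move=> blk; rewrite /scratch ltnNge (leq_trans (leq_addr _ _) blk) /=.
by rewrite nth_default //; lia.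
Qed.

Lemma update_scratch b r l i v :
  update (scratch b r l) (b + i) v = scratch b r (set_nth 0 l i v).
Proof.
apply/funext => x; rewrite /update /scratch nth_set_nth /=.
case: (ltnP x b) => xb; case: (x =P _) => e; case: (x - b =P i) => //; lia.
Qed.

Lemma update_scratch_low b r l o v : o < b ->
  update (scratch b r l) o v = scratch b (update r o v) l.
Proof.
move=> ob; apply/funext => x; rewrite /update /scratch.
by case: eqVneq => // ->; rewrite ob.
Qed.

Lemma map_scratch b r l a :
  all (fun x => x < b) a -> map (scratch b r l) a = map r a.
Proof. by move=> /allP ab; apply/eq_in_map => x /ab; apply: scratch_low. Qed.

Lemma scratch_rcons0 b r l : scratch b r (rcons l 0) = scratch b r l.
Proof.
apply/funext => x; rewrite /scratch nth_rcons.
by case: ltnP => // _; case: ltngtP => // ?; rewrite nth_default //; lia.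
Qed.

Definition implements n (f : recfun n) (a : seq nat) o b p :=
  forall r (v : n.-tuple nat) y, (forall k, b <= k -> r k = 0) ->
  map r a = v -> computes f v y -> exec p r (update r o (r o + y)).

Definition compilable n (f : recfun n) :=
  forall a o b, all (fun x => x < b) a -> o < b -> o \notin a ->
  exists p, implements f a o b p.

Lemma compile_Zero : compilable RZero.
Proof.
move=> a o b _ ob _; exists (skip b) => r v y r0 _ /= ->.
by rewrite addn0 update_id //; apply/exec_skip/r0.
Qed.

Lemma exec_copy_arg a o b i r : all (fun x => x < b) a -> o < b ->
  o \notin a -> i < size a -> (forall k, b <= k -> r k = 0) ->
  exec (copy (nth 0 a i) o b) r (update r o (r o + nth 0 (map r a) i)).
Proof.
move=> /allP ab ob oa ia r0; have ai := mem_nth 0 ia; have := ab _ ai.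
rewrite (nth_map 0) // => aib; apply: exec_copy.
- by apply: contraNneq oa => <-.
- by rewrite ltn_eqF.
- by rewrite ltn_eqF.
- exact: r0.
Qed.

Lemma size_args n (v : n.-tuple nat) (r : nat -> nat) a :
  map r a = v -> size a = n.
Proof. by move=> /(congr1 size); rewrite size_map size_tuple. Qed.

Lemma compile_Succ : compilable RSucc.
Proof.
move=> a o b ab ob oa; exists (Seq (copy (nth 0 a 0) o b) (Inc o)).
move=> r v y r0 av.
have sa := size_args av; rewrite /= => ->.
apply: exec_Seq (exec_copy_arg ab ob oa _ r0) _; first by rewrite sa.
rewrite av; set r' := update _ _ _.
have -> : update r o (r o + (thead v).+1) = update r' o (r' o).+1.
  by rewrite /r' /thead (tnth_nth 0) /=; update_ext.
exact: exec_Inc.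
Qed.

Lemma compile_Proj n (i : 'I_n) : compilable (RProj i).
Proof.
move=> a o b ab ob oa; exists (copy (nth 0 a i) o b) => r v y r0 av /= ->.
have sa := size_args av; rewrite (tnth_nth 0) -av.
by apply: exec_copy_arg; rewrite ?sa.
Qed.

Lemma set_nth_rcons l x y : set_nth 0 (rcons l x) (size l) y = rcons l y.
Proof. by elim: l => //= z l ->. Qed.

Lemma clear_scratch b k m : m <= k ->
  exists p, forall r l, size l = m -> exec p (scratch b r l) (scratch b r [::]).
Proof.
elim: m => [|m IH] mk.
  exists (skip (b + k)) => r l /size0nil ->; apply: exec_skip.
  by apply: scratch_high => /=; lia.
have [p pP] := IH (ltnW mk); exists (Seq (clear (b + m) (b + k)) p) => r l.
case/lastP: l => [//|l x]; rewrite size_rcons => -[lm].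
apply: exec_Seq (exec_clear _ _) _; [lia|apply: scratch_high|].
  by rewrite size_rcons lm; lia.
by rewrite update_scratch -{1}lm set_nth_rcons scratch_rcons0; apply: pP.
Qed.

Lemma set_nth_size (l : seq nat) y : set_nth 0 l (size l) y = rcons l y.
Proof. by elim: l => //= z l ->. Qed.

Lemma scratch_nseq0 b r m : scratch b r (nseq m 0) = scratch b r [::].
Proof.
apply/funext => x; rewrite /scratch nth_nil.
by case: ltnP => // _; rewrite nth_nseq if_same.
Qed.

Section ScratchSteps.

Variables (b : nat) (r : nat -> nat) (l : seq nat).

Lemma exec_clear_scratch i j : i != j -> nth 0 l j = 0 ->
  exec (clear (b + i) (b + j)) (scratch b r l) (scratch b r (set_nth 0 l i 0)).
Proof.
move=> ij lj; rewrite -update_scratch.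
by apply: exec_clear; rewrite ?eqn_add2l // scratchD.
Qed.

Lemma exec_move_scratch i j : i != j ->
  exec (move (b + i) (b + j)) (scratch b r l)
    (scratch b r (set_nth 0 (set_nth 0 l j (nth 0 l j + nth 0 l i)) i 0)).
Proof.
move=> ij; rewrite -!update_scratch -!(scratchD b r).
by apply: exec_move; rewrite eqn_add2l.
Qed.

Lemma exec_move_out i o : o < b ->
  exec (move (b + i) o) (scratch b r l)
    (scratch b (update r o (r o + nth 0 l i)) (set_nth 0 l i 0)).
Proof.
move=> ob; have /(@exec_move _ _ (scratch b r l)) : b + i != o by lia.
by rewrite scratchD scratch_low // update_scratch_low // update_scratch.
Qed.

Lemma exec_Inc_scratch i :
  exec (Inc (b + i)) (scratch b r l)
    (scratch b r (set_nth 0 l i (nth 0 l i).+1)).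
Proof. by rewrite -update_scratch -(scratchD b r); apply: exec_Inc. Qed.

Lemma exec_implements n (f : recfun n) a i j p (v : n.-tuple nat) y :
  implements f a (b + i) (b + j) p -> size l <= j ->
  map (scratch b r l) a = v -> computes f v y ->
  exec p (scratch b r l) (scratch b r (set_nth 0 l i (nth 0 l i + y))).
Proof.
move=> pP lj av fy; rewrite -update_scratch -(scratchD b r).
by apply: pP av fy => k bk; apply: scratch_high; lia.
Qed.

End ScratchSteps.

Lemma args_lt a b j : all (fun x => x < b) a -> all (fun x => x < b + j) a.
Proof. by move=> ab; apply: sub_all ab => x /= xb; lia. Qed.

Lemma args_notin a b j : all (fun x => x < b) a -> b + j \notin a.
Proof. by move=> /allP ab; apply/negP => /ab; lia. Qed.

Lemma scratch_out b r o v :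
  o < b -> (forall k, b <= k -> r k = 0) ->
  scratch b (update r o v) [::] = update r o v.
Proof.
move=> ob r0; apply: scratch_nil => k bk; rewrite /update.
by case: eqVneq => [|_]; [lia|apply: r0].
Qed.

Lemma compile_Comp n k (g : recfun k) (h : 'I_k -> recfun n) :
  compilable g -> (forall i, compilable (h i)) -> compilable (RComp g h).
Proof.
move=> cg ch a o b ab ob oa.
have /choice[P PP] (i : 'I_k) : exists p, implements (h i) a (b + i) (b + k) p.
  by apply: ch; [apply: args_lt|rewrite ltn_add2l|apply: args_notin].
have [G GP] : exists p, implements g (iota b k) o (b + k) p.
  apply: cg; [by apply/allP => x; rewrite mem_iota => /andP[]|lia|].
  by rewrite mem_iota; lia.
have [C CP] := clear_scratch b (leqnn k).
have ev m : m <= k ->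
    exists p, forall r (v : n.-tuple nat) (w : k.-tuple nat),
    map r a = v -> (forall i, computes (h i) v (tnth w i)) ->
    exec p (scratch b r [::]) (scratch b r (take m w)).
  elim: m => [|m IH] mk.
    exists (skip (b + k)) => r v w _ _; rewrite take0; apply: exec_skip.
    by rewrite scratchD nth_nil.
  have [p pP] := IH (ltnW mk); exists (Seq p (P (Ordinal mk))) => r v w av hw.
  apply: exec_Seq (pP _ _ _ av hw) _.
  have sm : size (take m w) = m by rewrite size_takel // size_tuple ltnW.
  have := exec_implements (PP (Ordinal mk)) _ _ (hw (Ordinal mk)) .
  move=> /(_ r (take m w)); rewrite sm map_scratch // => /(_ (ltnW mk) av) /=.
  rewrite nth_default ?sm // add0n.
  have := set_nth_size (take m w) (tnth w (Ordinal mk)); rewrite sm => ->.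
  by rewrite (tnth_nth 0) /= -take_nth ?size_tuple.
have [p pP] := ev k (leqnn k).
exists (Seq p (Seq G C)) => r v y r0 av [w hw gw].
have := pP r v w av hw; rewrite take_oversize ?size_tuple // scratch_nil //.
move=> /exec_Seq; apply; apply: exec_Seq (GP _ w _ _ _ gw) _.
- by move=> x bx; apply: scratch_high; rewrite size_tuple.
- apply: (@eq_from_nth _ 0); first by rewrite size_map size_iota size_tuple.
  move=> i; rewrite size_map size_iota => ik.
  by rewrite (nth_map 0) ?size_iota // nth_iota // scratchD.
rewrite update_scratch_low // scratch_low //.
rewrite -[X in exec _ _ X](scratch_out _ ob r0).
by apply: CP; rewrite size_tuple.
Qed.

Lemma compile_Prim n (g : recfun n) (h : recfun n.+2) :
  compilable g -> compilable h -> compilable (RPrim g h).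
Proof.
move=> cg ch a o b ab ob oa.
have ab' : all (fun x => x < b) (behead a) by case: (a) ab => //= x s /andP[].
have [G GP] : exists p, implements g (behead a) (b + 1) (b + 4) p.
  by apply: cg; [apply: args_lt|rewrite ltn_add2l|apply: args_notin].
have [H HP] : exists p,
    implements h (b + 0 :: b + 1 :: behead a) (b + 2) (b + 4) p.
  apply: ch; last by rewrite !inE negb_or !eqn_add2l /= args_notin.
    by rewrite /= !ltn_add2l args_lt.
  by rewrite ltn_add2l.
pose body := Seq H (Seq (clear (b + 1) (b + 4))
  (Seq (move (b + 2) (b + 1)) (Inc (b + 0)))).
exists (Seq (copy (nth 0 a 0) (b + 3) (b + 4)) (Seq G (Seq (Loop (b + 3) body)
  (Seq (move (b + 1) o) (clear (b + 0) (b + 4)))))).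
move=> r v y r0 av [s [gs hs ->]].
have sa := size_args av; set m := thead v.
have av' : map r (behead a) = behead v by rewrite -av behead_map.
have rm : r (nth 0 a 0) = m.
  by rewrite /m /thead (tnth_nth 0) -av (nth_map 0) // sa.
have a0b : nth 0 a 0 < b by apply: (allP ab); rewrite mem_nth // sa.
(* In order: the recursion index, the value there, room for the next value, and the number of passes
   left. *)
pose st i := scratch b r [:: i; s i; 0; m - i].
have exec_init : exec (copy (nth 0 a 0) (b + 3) (b + 4)) r
    (scratch b r [:: 0; 0; 0; m]).
  have := @exec_copy (nth 0 a 0) (b + 3) (b + 4) (scratch b r [::]).
  rewrite (scratch_low _ _ a0b) rm !scratchD !nth_nil.
  rewrite update_scratch scratch_nil //=.
  by apply; lia.
have exec_base : exec G (scratch b r [:: 0; 0; 0; m]) (st 0).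
  rewrite /st subn0; apply: exec_implements GP _ _ gs => //.
  by rewrite map_scratch.
have exec_loop : exec (Loop (b + 3) body) (st 0) (st m).
  apply: exec_for => i im; first by rewrite /st scratchD.
  rewrite /st update_scratch /=.
  apply: exec_Seq (exec_implements HP _ _ (hs i im)) _ => //.
    by rewrite /= !scratchD map_scratch ?av'.
  apply: exec_Seq (exec_clear_scratch _ _ _ _) _ => //.
  apply: exec_Seq (exec_move_scratch _ _ _ _) _ => //.
  exact: exec_Inc_scratch.
apply: (exec_Seq exec_init (exec_Seq exec_base (exec_Seq exec_loop _))).
apply: exec_Seq (exec_move_out _ _ _ ob) _.
rewrite -[X in exec _ _ X](scratch_out _ ob r0) -(scratch_nseq0 _ _ 4) /=.
by rewrite subnn; apply: exec_clear_scratch.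
Qed.

Lemma compile_Mu n (g : recfun n.+1) : compilable g -> compilable (RMu g).
Proof.
move=> cg a o b ab ob oa.
have [G GP] : exists p, implements g (b + 0 :: a) (b + 1) (b + 2) p.
  apply: cg; last by rewrite inE negb_or eqn_add2l args_notin.
    by rewrite /= ltn_add2l args_lt.
  by rewrite ltn_add2l.
(* Register [b] holds the candidate and [b + 1] the value of [g] at it. A positive value starts
   another pass, which discards what the test left of it and tries the next candidate. *)
pose body := Seq (clear (b + 1) (b + 2)) (Seq (Inc (b + 0)) G).
exists (Seq G (Seq (Loop (b + 1) body) (move (b + 0) o))).
move=> r v y r0 av [gy gi].
have exec_G i k : computes g (cons_tuple i v) k ->
    exec G (scratch b r [:: i; 0]) (scratch b r [:: i; k]).
  move=> gk; apply: exec_implements GP _ _ gk => //.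
  by rewrite /= scratchD map_scratch // av.
have value i : i <= y ->
    exists2 k, computes g (cons_tuple i v) k & (k == 0) = (i == y).
  rewrite leq_eqVlt => /predU1P[->|iy]; first by exists 0; rewrite ?eqxx.
  by have [k gk] := gi i iy; exists k.+1; rewrite ?(ltn_eqF iy).
have exec_loop d i k : i + d = y -> (k == 0) = (i == y) ->
    exec (Loop (b + 1) body) (scratch b r [:: i; k]) (scratch b r [:: y; 0]).
  elim: d i k => [|d IH] i k.
    rewrite addn0 => ->; rewrite eqxx => /eqP ->.
    by apply: exec_Loop0; rewrite scratchD.
  move=> idy; rewrite (ltn_eqF (_ : i < y)); last by lia.
  case: k => // k _; have [|k' gk' k'0] := value i.+1; first by lia.
  apply: (exec_LoopS (m := k)); [by rewrite scratchD| |apply: IH k'0; lia].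
  rewrite update_scratch /=.
  apply: exec_Seq (exec_clear_scratch _ _ _ _) _ => //.
  by apply: exec_Seq (exec_Inc_scratch _ _ _ _) _; apply: exec_G.
have [k gk k0] := value 0 (leq0n y).
have := exec_G _ _ gk; rewrite (scratch_nseq0 b r 2) scratch_nil //.
move=> /exec_Seq; apply.
apply: exec_Seq (exec_loop y 0 k _ k0) _ => //.
rewrite -[X in exec _ _ X](scratch_out _ ob r0) -(scratch_nseq0 _ _ 2).
exact: exec_move_out.
Qed.

Lemma recfun_compilable n (f : recfun n) : compilable f.
Proof.
elim: f => [||n' i|n' k g IHg h IHh|n' g IHg h IHh|n' g IHg].
- exact: compile_Zero.
- exact: compile_Succ.
- exact: compile_Proj.
- exact: compile_Comp.
- exact: compile_Prim.
- exact: compile_Mu.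
Qed.

(** * Undecidability *)

Lemma run_None S (prog : S -> instr (option S)) q r i j :
  i <= j -> (run prog q r i).1 = None -> (run prog q r j).1 = None.
Proof.
move=> ij; case e: (run prog q r i) => [q' r'] /= q'0; rewrite q'0 in e.
by rewrite -(subnKC ij) (runD _ e) run_halted.
Qed.

Section Switch.

Variables (p : cmd) (r r' : nat -> nat).

(** This reverses the answer left by [p] in register 1: on 0 the machine halts, on 1 it decrements
    and increments the register for ever. *)
Definition switch := Seq p (Loop 1 (Inc 1)).

Let delta := @cmd_instr switch.
Let start := Some (cmd_entry switch).

Hypothesis pr : exec p r r'.

Lemma switch_halts : r' 1 = 0 -> exists j, (run delta start r j).1 = None.
Proof.
move=> r1; have [j e] := exec_Seq pr (exec_Loop0 (Inc 1) r1).
by exists j; rewrite e.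
Qed.

Lemma switch_diverges : r' 1 = 1 -> forall j, (run delta start r j).1 <> None.
Proof.
(* The loop has period 2, so two consecutive times are treated together. *)
have loop j s : s 1 = 1 -> (run delta (Some (inr None)) s j).1 <> None /\
    (run delta (Some (inr None)) s j.+1).1 <> None.
  elim: j s => [|j IH] s s1; first by rewrite /run /= /step /= s1.
  split; first by have [] := IH s s1.
  have e : run delta (Some (inr None)) s 2 =
      (Some (inr None), update (update s 1 0) 1 1).
    by rewrite /run /= /step /= s1.
  rewrite -[j.+2]/(2 + j)%N (runD _ e).
  by have [] := IH (update (update s 1 0) 1 1) (erefl _).
move=> r1; have [i e] := pr.
have [|i' e'] := run_embed (prog' := delta) (e := inl)
  (x := Some (inr None)) _ e; first by [].
move=> j /(run_None (leq_addl i' j)).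
by rewrite (runD _ e'); have [] := loop j r' r1.
Qed.

End Switch.

(** * Recursive functions on codes of formulas *)

Definition computable n (g : seq nat -> nat) :=
  exists f : recfun n, forall v : n.-tuple nat, computes f v (g v).

Lemma computable_ext n (g h : seq nat -> nat) :
  (forall v : n.-tuple nat, g v = h v) -> computable n g -> computable n h.
Proof. by move=> gh [f fP]; exists f => v; rewrite -gh. Qed.

Lemma computable_nth n i : i < n -> computable n (fun s => nth 0 s i).
Proof.
by move=> lt; exists (RProj (Ordinal lt)) => v /=; rewrite (tnth_nth 0).
Qed.

Lemma computable_comp1 n g h : computable 1 (fun s => g (nth 0 s 0)) ->
  computable n h -> computable n (fun s => g (h s)).
Proof.
move=> [f fP] [e eP]; exists (RComp f (fun=> e)) => v.
exists [tuple h v]; last exact: fP.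
by move=> i; rewrite (tnth_nth 0) ord1; apply: eP.
Qed.

Lemma computable_comp2 n g h1 h2 :
  computable 2 (fun s => g (nth 0 s 0) (nth 0 s 1)) ->
  computable n h1 -> computable n h2 -> computable n (fun s => g (h1 s) (h2 s)).
Proof.
move=> [f fP] [e1 eP1] [e2 eP2].
exists (RComp f (fun i : 'I_2 => if i == 0 :> nat then e1 else e2)) => v.
exists [tuple h1 v; h2 v]; last exact: fP.
by case=> -[|[|//]] lt; rewrite (tnth_nth 0) /=.
Qed.

Lemma computable_succ : computable 1 (fun s => (nth 0 s 0).+1).
Proof. by exists RSucc => v; rewrite /= /thead (tnth_nth 0). Qed.

Lemma computable_const n c : computable n (fun=> c).
Proof.
elim: c => [|c IH].
  have h : 'I_0 -> recfun n by case.
  exists (RComp RZero h) => v; exists [tuple] => //; by case.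
exact: computable_comp1 computable_succ IH.
Qed.

Lemma computable_prim n g h (F : nat -> seq nat -> nat) :
  computable n g -> computable n.+2 h -> (forall s, F 0 s = g s) ->
  (forall i s, F i.+1 s = h [:: i, F i s & s]) ->
  computable n.+1 (fun s => F (nth 0 s 0) (behead s)).
Proof.
move=> [f fP] [e eP] F0 FS; exists (RPrim f e) => v.
exists (fun i => F i (behead v)); split=> [|i _|].
- by rewrite F0; apply: (fP (behead_tuple v)).
- by rewrite FS; apply: eP.
- by rewrite /thead (tnth_nth 0).
Qed.

Lemma computable_add : computable 2 (fun s => (nth 0 s 0 + nth 0 s 1)%N).
Proof.
apply: (computable_ext (g := fun s => (nth 0 s 0 + nth 0 (behead s) 0)%N)).
  by move=> v; rewrite nth_behead.
apply: (@computable_prim 1 (fun s => nth 0 s 0) (fun s => (nth 0 s 1).+1)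
  (fun i s => (i + nth 0 s 0)%N)) => //; first exact: computable_nth.
by apply: computable_comp1 computable_succ _; apply: computable_nth.
Qed.

Lemma computable_cpair : computable 2 (fun s => cpair (nth 0 s 0) (nth 0 s 1)).
Proof.
rewrite /cpair.
apply: (computable_comp2 computable_add); last exact: computable_nth.
apply: (computable_comp1 (g := fun x => 'C(x.+1, 2)));
  last exact: computable_add.
apply: (@computable_prim 0 (fun=> 0) (fun s => (nth 0 s 1 + (nth 0 s 0).+1)%N)
  (fun i s => 'C(i.+1, 2))) => //; first exact: computable_const.
  apply: (computable_comp2 computable_add); first exact: computable_nth.
  by apply: computable_comp1 computable_succ _; apply: computable_nth.
by move=> i s /=; rewrite binS bin1.
Qed.

Lemma computable_pair n g h :
  computable n g -> computable n h -> computable n (fun s => cpair (g s) (h s)).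
Proof. exact: computable_comp2 computable_cpair. Qed.

Lemma computable_input :
  computable 1 (fun s => code (input_formula (nth 0 s 0))).
Proof.
apply: (@computable_prim 0 (fun=> code marked)
  (fun s => cpair 3 (cpair 5 (cpair (code hstep) (cpair 3 (nth 0 s 1)))))
  (fun i s => code (input_formula i))) => //; first exact: computable_const.
do 3!(apply: computable_pair; first exact: computable_const).
apply: computable_pair; first exact: computable_const.
exact: computable_nth.
Qed.

(** Self-application: if [n] codes a tiling formula, this codes its refutation formula for the input
    [n]. *)
Definition diagonal_code n :=
  cpair 4 (cpair (cpair 3 n) (cpair 3 (code (input_formula n)))).

Lemma code_diagonal a :
  code (Or (Neg a) (Neg (input_formula (code a)))) = diagonal_code (code a).
Proof. by []. Qed.

Lemma computable_diagonal_code :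
  computable 1 (fun s => diagonal_code (nth 0 s 0)).
Proof.
apply: computable_pair; first exact: computable_const.
apply: computable_pair.
  by apply: computable_pair; [apply: computable_const|apply: computable_nth].
by apply: computable_pair; [apply: computable_const|apply: computable_input].
Qed.

Lemma undecidable_between (L : set formula) :
  logic_of class789 `<=` L -> L `<=` logic_of class7810 -> undecidable L.
Proof.
move=> lo hi [f fP]; have [g gP] := computable_diagonal_code.
have [p pP] : exists p, implements (RComp f (fun=> g)) [:: 0] 1 2 p.
  exact: recfun_compilable.
have pr n b : computes f [tuple diagonal_code n] b ->
    exec p (input n) (update (input n) 1 b).
  move=> fb; apply: (pP _ [tuple n]) => [k k2||].
  - by rewrite /input /update; case: k k2.
  - by [].
  - exists [tuple diagonal_code n]; last exact: fb.
    by move=> i; rewrite (tnth_nth 0) ord1; apply: (gP [tuple n]).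
pose prog := @cmd_instr (switch p).
(* The tiling formula of the very machine that will be run on the code of [psi]. *)
pose psi := tiling_formula (@t_right _ prog) (@t_above _ prog)
  (@t_start _ prog (cmd_entry (switch p))) (@t_mark _ prog).
have [b []] := fP (Or (Neg psi) (Neg (input_formula (code psi)))).
rewrite code_diagonal => /pr {}pr Lb.
have r1 : update (input (code psi)) 1 b 1 = b by rewrite /update eqxx.
(* If the formula is in [L], the machine runs for ever, and the resulting tiling refutes the formula
   in the smaller class. If it is not, the machine halts, some strip has no tiling, and the formula
   is valid in the larger class. *)
case: b Lb pr r1 => Lb pr r1.
  have [t tP] := tiling_of_run (switch_diverges pr r1).
  exact: sat_of_tiling tP (hi _ (Lb.2 isT)).
have [M halted] := switch_halts pr r1.
by have /lo/Lb := logic_of_no_tiling (no_tiling_of_halting halted).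
Qed.

Theorem theorem1p9 :
  [/\ undecidable (K2_plus [set ax7; ax8; ax9]),
      undecidable (K2_plus [set ax7; ax8; ax10]),
      (K2_plus [set ax7; ax8; ax9] = logic_of class789 /\
       undecidable (logic_of class789))
    & (K2_plus [set ax7; ax8; ax10] = logic_of class7810 /\
       undecidable (logic_of class7810))].
Proof.
have u9 : undecidable (logic_of class789).
  by apply: undecidable_between logic_789_7810.
have u10 : undecidable (logic_of class7810).
  by apply: undecidable_between logic_789_7810 _.
by rewrite K2_plus_789 K2_plus_7810.
Qed.
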